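(* Let $d\ge 2$. For every $u\in(0,u_c(d))$, the number of infinite (i.e. unbounded) connected components of the occupied set $\mathcal{C}$ of the Poisson cylinder model of intensity $u$ in $\mathbb{H}^d$ is almost surely infinite.
   Context: $\mathbb{H}^d$ is $d$-dimensional hyperbolic space (curvature $-1$), with metric $d_H$ and a fixed origin $o$; $B(x,r)$ is the closed hyperbolic ball. $A(d,1)$ is the set of all bi-infinite geodesics (lines) in $\mathbb{H}^d$. For $K\subset\mathbb{H}^d$ let $\mathcal{L}_K=\{L\in A(d,1): L\cap K\neq\emptyset\}$. $\mu_{d,1}$ is the unique measure on $A(d,1)$ invariant under isometries of $\mathbb{H}^d$ and normalized by $\mu_{d,1}(\mathcal{L}_{B(o,1)})=O_{d-1}$, where $O_{d-1}$ is the $(d-1)$-dimensional volume of the Euclidean unit sphere $\mathbb{S}^{d-1}$. For $u>0$, $\omega$ is a Poisson point process on $A(d,1)$ with intensity measure $u\mu_{d,1}$. For a line $L$, $\mathfrak{c}(L)=\{x\in\mathbb{H}^d: d_H(x,L)\le 1\}$. The occupied set is $\mathcal{C}=\bigcup_{L\in\omega}\mathfrak{c}(L)$, and $$u_c(d)=\inf\{u>0: \mathcal{C}\text{ is a.s. a connected set}\}.$$ *)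

(* Defs.v *)
From HB Require Import structures.
From mathcomp Require Import all_boot all_order all_algebra.
From mathcomp Require Import ring lra.
From mathcomp Require Import all_classical all_reals all_analysis.
From mathcomp Require Import measurable_realfun.

Set Implicit Arguments.
Unset Strict Implicit.
Unset Printing Implicit Defensive.

Import Order.TTheory GRing.Theory Num.Theory.
Import numFieldNormedType.Exports.

Local Open Scope classical_set_scope.
Local Open Scope ring_scope.

(* Hyperbolic space H^d, in the hyperboloid model: the upper sheet of          *)
(* <x, x> = -1 in R^(d+1) with the Lorentz form <., .>, and                    *)
(* d_H(x, y) = arcosh (- <x, y>).                                              *)

Definition arcosh {R : realType} (a : R) : R := ln (a + Num.sqrt (a ^+ 2 - 1)).

Section Lorentz.
Context {R : realType} {d : nat}.
Implicit Types x y z : 'rV[R]_d.+1.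

Definition lorentz x y : R :=
  - (x 0 0 * y 0 0) + \sum_(i < d) x 0 (lift ord0 i) * y 0 (lift ord0 i).

Lemma lorentzC x y : lorentz x y = lorentz y x.
Proof.
rewrite /lorentz mulrC; congr (_ + _).
by apply: eq_bigr => i _; rewrite mulrC.
Qed.

Lemma lorentzDl x y z : lorentz (x + y) z = lorentz x z + lorentz y z.
Proof.
rewrite /lorentz mxE mulrDl opprD addrACA; congr (_ + _).
by rewrite -big_split /=; apply: eq_bigr => i _; rewrite mxE mulrDl.
Qed.

Lemma lorentzZl a x z : lorentz (a *: x) z = a * lorentz x z.
Proof.
rewrite /lorentz mxE mulrDr mulr_sumr mulrN mulrA; congr (_ + _).
by apply: eq_bigr => i _; rewrite mxE mulrA.
Qed.

Lemma lorentzDr x y z : lorentz z (x + y) = lorentz z x + lorentz z y.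
Proof. by rewrite lorentzC lorentzDl !(lorentzC z). Qed.

Lemma lorentzZr a x z : lorentz z (a *: x) = a * lorentz z x.
Proof. by rewrite lorentzC lorentzZl (lorentzC z). Qed.

End Lorentz.

Record hyp (R : realType) (d : nat) := Hyp {
  hval :> 'rV[R]_d.+1 ;
  hvalP : (0 < hval 0 0) && (lorentz hval hval == -1) }.

HB.instance Definition _ R d := [isSub for @hval R d].
HB.instance Definition _ R d := [Choice of hyp R d by <:].

Definition hdist {R : realType} {d : nat} (x y : hyp R d) : R :=
  arcosh (- lorentz x y).

Section HyperbolicMetric.
Context {R : realType} {d : nat}.
Implicit Types x y z : hyp R d.

Lemma quad_disc (A B C : R) :
  (forall s t, 0 <= A * s ^+ 2 + 2 * B * s * t + C * t ^+ 2) ->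
  B ^+ 2 <= A * C.
Proof.
move=> h; have C0 : 0 <= C by have := h 0 1; nra.
have := h C (- B); case: (eqVneq C 0) => [C00|C1 hC].
  move: h; rewrite C00 => h _.
  have := h 1 (- (A + 1) * B); have A0 : 0 <= A by have := h 1 0; nra.
  move=> hh; have B0 : B = 0; last by rewrite B0; lra.
  have {}hh : 0 <= A - 2 * (A + 1) * B ^+ 2 by nra.
  have := h 1 (- (A + 1) / B); case: (eqVneq B 0) => // B0.
  have -> : A * 1 ^+ 2 + 2 * B * 1 * (- (A + 1) / B) + 0 * (- (A + 1) / B) ^+ 2
    = A - 2 * (A + 1) by field.
  lra.
have Cp : 0 < C by rewrite lt_neqAle eq_sym C1.
rewrite -(ler_pM2l Cp); nra.
Qed.

Lemma lorentz_self x : lorentz x x = -1.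
Proof. by case: x => x /= /andP[_ /eqP]. Qed.

Lemma time_gt0 x : 0 < (x : 'rV_d.+1) 0 0.
Proof. by case: x => x /= /andP[]. Qed.

Let spc (v w : 'rV[R]_d.+1) := \sum_(i < d) v 0 (lift ord0 i) * w 0 (lift ord0 i).

Let spc_cs v w : spc v w ^+ 2 <= spc v v * spc w w.
Proof.
apply: quad_disc => s t.
rewrite [leRHS](_ : _ = \sum_(i < d)
    (s * v 0 (lift ord0 i) + t * w 0 (lift ord0 i)) ^+ 2); last first.
  rewrite /spc !mulr_suml mulr_sumr !mulr_suml -!big_split /=.
  by apply: eq_bigr => i _; ring.
by apply: sumr_ge0 => i _; exact: sqr_ge0.
Qed.

Let spc_ge0 v : 0 <= spc v v.
Proof. by apply: sumr_ge0 => i _; rewrite -expr2 sqr_ge0. Qed.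

Let lorentzE v w : lorentz v w = - (v 0 0 * w 0 0) + spc v w.
Proof. by []. Qed.

Let tangent y (v : 'rV_d.+1) : lorentz v y = 0 ->
  spc v v <= (y : 'rV_d.+1) 0 0 ^+ 2 * lorentz v v.
Proof.
move=> vy; have := spc_cs v y; have := lorentz_self y.
move: vy; rewrite !lorentzE => vy yy.
have -> : spc v y = v 0 0 * (y : 'rV_d.+1) 0 0 by lra.
have -> : spc y y = (y : 'rV_d.+1) 0 0 ^+ 2 - 1 by lra.
nra.
Qed.

Let tangent_ge0 y (v : 'rV_d.+1) : lorentz v y = 0 -> 0 <= lorentz v v.
Proof.
move=> /tangent h; have := le_trans (spc_ge0 v) h.
by rewrite pmulr_rge0// exprn_gt0// time_gt0.
Qed.

Let tangent_eq0 y (v : 'rV_d.+1) : lorentz v y = 0 -> lorentz v v = 0 -> v = 0.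
Proof.
move=> vy vv; have := tangent vy; rewrite vv mulr0 => s0.
have {s0}sv0 : spc v v = 0 by apply/eqP; rewrite eq_le s0 spc_ge0.
have v0 : v 0 0 = 0.
  by move: vv; rewrite lorentzE sv0 addr0 => /eqP; rewrite oppr_eq0 mulf_eq0 orbb => /eqP.
apply/rowP => i; rewrite mxE; case: (unliftP ord0 i) => [j ->|->//].
have /eqP := sv0; rewrite psumr_eq0; last by move=> k _; rewrite -expr2 sqr_ge0.
by move=> /allP/(_ j (mem_index_enum j)) /=; rewrite mulf_eq0 orbb => /eqP.
Qed.

Let proj x y : 'rV[R]_d.+1 := hval x + lorentz x y *: hval y.

Let proj_orth x y : lorentz (proj x y) y = 0.
Proof. by rewrite /proj lorentzDl lorentzZl lorentz_self; ring. Qed.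

Let proj_prod x y z :
  lorentz (proj x y) (proj z y) = lorentz x z + lorentz x y * lorentz y z.
Proof.
rewrite /proj !(lorentzDl, lorentzDr, lorentzZl, lorentzZr) lorentz_self.
by rewrite (lorentzC z y); ring.
Qed.

Lemma lorentz_ge1 x y : 1 <= - lorentz x y.
Proof.
have := tangent_ge0 (proj_orth x y).
rewrite proj_prod lorentz_self (lorentzC y x) => h.
suff: 0 < - lorentz x y by nra.
have := spc_cs x y; have := lorentz_self x; have := lorentz_self y.
have := time_gt0 x; have := time_gt0 y.
rewrite !lorentzE.
set a := (x : 'rV_d.+1) 0 0; set b := (y : 'rV_d.+1) 0 0.
move=> b0 a0 yy xx.
have -> : spc x x = a ^+ 2 - 1 by lra.
have -> : spc y y = b ^+ 2 - 1 by lra.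
move=> cs; have ab : 0 < a * b by rewrite mulr_gt0.
rewrite opprD opprK subr_gt0; rewrite ltNge; apply/negP => abs.
have h1 : 1 <= a ^+ 2 by have := spc_ge0 x; lra.
have h2 : 1 <= b ^+ 2 by have := spc_ge0 y; lra.
have : (a * b) ^+ 2 <= spc x y ^+ 2 by rewrite ler_sqr ?nnegrE; lra.
rewrite exprMn; nra.
Qed.

Let tangent_cs y (v w : 'rV_d.+1) : lorentz v y = 0 -> lorentz w y = 0 ->
  lorentz v w ^+ 2 <= lorentz v v * lorentz w w.
Proof.
move=> vy wy; apply: quad_disc => s t.
have := @tangent_ge0 y (s *: v + t *: w).
rewrite !(lorentzDl, lorentzDr, lorentzZl, lorentzZr) vy wy !mulr0 addr0.
by rewrite (lorentzC w v) => /(_ erefl); congr (0 <= _); ring.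
Qed.

Lemma lorentz_triangle x y z :
  - lorentz x z <= lorentz x y * lorentz y z +
    Num.sqrt (lorentz x y ^+ 2 - 1) * Num.sqrt (lorentz y z ^+ 2 - 1).
Proof.
have := tangent_cs (proj_orth x y) (proj_orth z y).
rewrite !proj_prod !lorentz_self (lorentzC y x) (lorentzC z y).
have := lorentz_ge1 x y; have := lorentz_ge1 y z.
set a := lorentz x y; set b := lorentz y z; set c := lorentz x z => b1 a1 h.
rewrite -sqrtrM; last by nra.
rewrite -lerBlDl.
apply: le_trans (ler_norm _) _.
rewrite -sqrtr_sqr ler_sqrt; last by rewrite mulr_ge0; nra.
apply: le_trans (le_trans h _); rewrite le_eqVlt; apply/orP; left; apply/eqP; ring.
Qed.

Let sqrt_sub (a : R) : 1 <= a -> Num.sqrt (a ^+ 2 - 1) ^+ 2 = a ^+ 2 - 1.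
Proof. by move=> a1; rewrite sqr_sqrtr//; nra. Qed.

Lemma arcosh_triangle (a b c : R) : 1 <= a -> 1 <= b -> 1 <= c ->
  c <= a * b + Num.sqrt (a ^+ 2 - 1) * Num.sqrt (b ^+ 2 - 1) ->
  arcosh c <= arcosh a + arcosh b.
Proof.
move=> a1 b1 c1; rewrite /arcosh.
have := sqrt_sub a1; have := sqrt_sub b1.
have := sqrtr_ge0 (a ^+ 2 - 1); have := sqrtr_ge0 (b ^+ 2 - 1).
set s := Num.sqrt (a ^+ 2 - 1); set t := Num.sqrt (b ^+ 2 - 1).
move=> t0 s0 tt ss h.
rewrite -lnM ?posrE; [|lra|lra].
rewrite ler_ln ?posrE; last 2 first.
- by have := sqrtr_ge0 (c ^+ 2 - 1); lra.
- by rewrite mulr_gt0//; lra.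
suff : Num.sqrt (c ^+ 2 - 1) <= a * t + b * s by lra.
have p0 : 0 <= a * t + b * s by rewrite addr_ge0// mulr_ge0//; lra.
rewrite -[leRHS]ger0_norm// -sqrtr_sqr ler_sqrt ?sqr_ge0//.
have : c ^+ 2 <= (a * b + s * t) ^+ 2.
  by rewrite ler_sqr ?nnegrE//; lra.
have -> : (a * t + b * s) ^+ 2 = a ^+ 2 * t ^+ 2 + b ^+ 2 * s ^+ 2 + 2 * a * b * s * t by ring.
have -> : (a * b + s * t) ^+ 2 = a ^+ 2 * b ^+ 2 + s ^+ 2 * t ^+ 2 + 2 * a * b * s * t by ring.
by rewrite ss tt; lra.
Qed.

Lemma hdistxx x : hdist x x = 0.
Proof. by rewrite /hdist lorentz_self opprK /arcosh expr1n subrr sqrtr0 addr0 ln1. Qed.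

Lemma hdist_sym x y : hdist x y = hdist y x.
Proof. by rewrite /hdist lorentzC. Qed.

Lemma hdist_eq0 x y : hdist x y = 0 -> x = y.
Proof.
have xy1 := lorentz_ge1 x y; rewrite /hdist /arcosh => /eqP.
have s0 := sqrtr_ge0 ((- lorentz x y) ^+ 2 - 1).
rewrite ln_eq0; last by lra.
move=> /eqP e; have xy : lorentz x y = -1 by lra.
have := @tangent_eq0 y (proj x y) (proj_orth x y).
rewrite proj_prod lorentz_self (lorentzC y x) xy.
move=> /(_ ltac:(lra)); rewrite /proj xy scaleN1r => /eqP.
by rewrite subr_eq0 => /eqP ?; apply: val_inj.
Qed.

Lemma hdist_triangle y x z : hdist x z <= hdist x y + hdist y z.
Proof.
apply: arcosh_triangle; rewrite ?lorentz_ge1// mulrNN !sqrrN.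
exact: lorentz_triangle.
Qed.

End HyperbolicMetric.

HB.instance Definition _ (R : realType) (d : nat) :=
  isMetric.Build R (hyp R d) hdistxx hdist_eq0 hdist_sym hdist_triangle.

Lemma origin_subproof (R : realType) (d : nat) :
  let e := delta_mx 0 0 : 'rV[R]_d.+1 in (0 < e 0 0) && (lorentz e e == -1).
Proof.
rewrite /= /lorentz !mxE eqxx /= ltr01 mulr1 big1 ?addr0 ?eqxx// => i _.
by rewrite !mxE /= mul0r.
Qed.

Section Lines.
Variables (R : realType) (d : nat).

Definition origin : hyp R d := Hyp (origin_subproof R d).

Definition hball (x : hyp R d) (r : R) : set (hyp R d) :=
  [set y | mdist x y <= r].

Definition geodesic_lines : set (set (hyp R d)) :=
  [set L | exists2 gamma : R -> hyp R d,
     (forall s t, mdist (gamma s) (gamma t) = `|s - t|) & L = range gamma].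

Definition lines_hitting (K : set (hyp R d)) : set (set (hyp R d)) :=
  [set L | geodesic_lines L /\ L `&` K !=set0].

(* The Borel sigma-algebra of A(d,1) is generated by the sets L_K, K compact.  *)
(* It is carried by the type of all subsets of H^d (measurable types must be   *)
(* inhabited, and there is no line when d = 0): every L_K, hence               *)
(* A(d,1) = U_n L_{B(o,n)}, is measurable, the trace on A(d,1) is the Borel    *)
(* sigma-algebra and the complement of A(d,1) is an atom.                      *)
Definition line_space :=
  g_sigma_algebraType [set lines_hitting K | K in @compact (hyp R d)].

Definition isometry (g : hyp R d -> hyp R d) : Prop :=
  bijective g /\ (forall x y, mdist (g x) (g y) = mdist x y).

(* n-dimensional volume of the unit sphere S^n of R^(n+1). In geodesic polar   *)
(* coordinates about a pole S^(m+1) has metric dt^2 + (sin t)^2 g_{S^m},       *)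
(* 0 < t < pi; S^0 is two points.                                              *)
Fixpoint sphere_volume (n : nat) : R :=
  if n is m.+1 then
    sphere_volume m *
      (\int[@lebesgue_measure R]_(t in `[0, pi]) (sin t ^+ m))%R
  else 2.

(* The defining properties of mu_{d,1}; the first one says that mu lives on    *)
(* A(d,1).                                                                     *)
Definition invariant_line_measure (mu : {measure set line_space -> \bar R}) :=
  [/\ mu (~` geodesic_lines) = 0%E,
      (forall g, isometry g -> forall A : set line_space, measurable A ->
         mu [set g @` L | L in A] = mu A)
    & mu (lines_hitting (hball origin 1)) = (sphere_volume d.-1)%:E].

(* Realizations of the point process: the intensity has no atoms, so the       *)
(* process is simple and a realization is a locally finite set of lines.       *)
Definition locally_finite_lines : set (set (set (hyp R d))) :=
  [set w | w `<=` geodesic_lines /\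
     forall K, compact K -> finite_set (w `&` lines_hitting K)].

Definition line_config := set_type locally_finite_lines.

Lemma locally_finite_lines0 : set0 \in locally_finite_lines.
Proof. by rewrite inE; split=> // K _; rewrite set0I. Qed.

HB.instance Definition _ := Choice.on line_config.
HB.instance Definition _ := isPointed.Build line_config
  (exist _ set0 locally_finite_lines0).

Definition number_of_lines (B : set line_space) (w : line_config) : \bar R :=
  counting (val w `&` B : set line_space).

Definition config_space :=
  g_sigma_algebraType [set E : set line_config |
    exists (B : set line_space) (A : set (\bar R)),
      [/\ measurable B, measurable A & E = number_of_lines B @^-1` A]].

(* P is the law of a Poisson point process with intensity m. The probability   *)
(* mass function is spelled out because poisson_pmf is 1 at rate 0.            *)
Definition poisson_process (m : set line_space -> \bar R)
    (P : probability config_space R) : Prop :=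
  [/\ (forall B, measurable B -> (m B < +oo)%E -> forall n : nat,
         P (number_of_lines B @^-1` [set n%:R%:E]) =
         (fine (m B) ^+ n / n`!%:R * expR (- fine (m B)))%:E),
      (forall B, measurable B -> m B = +oo%E ->
         P (number_of_lines B @^-1` [set +oo%E]) = 1%E)
    & (forall (k : nat) (B : 'I_k -> set line_space) (x : 'I_k -> \bar R),
         (forall i, measurable (B i)) -> trivIset setT B ->
         P (\bigcap_i (number_of_lines (B i) @^-1` [set x i])) =
         (\prod_(i < k) P (number_of_lines (B i) @^-1` [set x i]))%E)].

Definition cylinder (L : set (hyp R d)) : set (hyp R d) :=
  [set x | inf [set mdist x y | y in L] <= 1].

Definition occupied (w : line_config) : set (hyp R d) :=
  \bigcup_(L in val w) cylinder L.

(* The Poisson law of given intensity exists and is unique, so it does not     *)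
(* matter whether P is quantified existentially or universally.                *)
Definition critical_intensity (mu : set line_space -> \bar R) : \bar R :=
  ereal_inf [set u%:E | u in [set u : R | 0 < u /\
    exists2 P : probability config_space R,
      poisson_process (fun B => u%:E * mu B)%E P &
      {ae P, forall w, connected (occupied w)}]].

Definition unbounded (D : set (hyp R d)) : Prop :=
  forall r, ~ D `<=` hball origin r.

Definition infinite_components (C : set (hyp R d)) : set (set (hyp R d)) :=
  [set D | (exists2 x, C x & D = connected_component C x) /\ unbounded D].

End Lines.

Arguments occupied {R d} w.
Arguments critical_intensity {R d} mu.
Arguments poisson_process {R d} m P.
Arguments infinite_components {R d} C.
Arguments invariant_line_measure {R d} mu.

(* Main.v *)
(* Call two lines of a configuration adjacent if their cylinders meet. By local
   finiteness, the components of the occupied set are the unions of the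
   cylinders over the classes of the generated equivalence. So if only finitely
   many of them are unbounded then, for some r, every line is linked to one that
   hits B(o, r): say that the configuration is rooted at r. Everything is
   measurable for the sigma-algebra generated by the void events (no line in B,
   for B bounded), which form a pi-system and have probability exp(- u mu B).
   - Insertion: a configuration rooted at r becomes connected after adding one
     line near each point of a finite net of B(o, r). Void events of disjoint
     sets are independent, so adding a line in B preserves positive probability
     as soon as mu B is positive and small.
   - Zero-one law: the measure of the lines hitting both B(o, r) and B(x, r)
     tends to 0 as x goes to infinity, because x may be moved to a horocycle, and
     a line hits only finitely many of the balls B(x_i, r) when x_i goes to
     infinity on a horocycle. Hence isometry-invariant events are independent of
     every void event.
   So if being rooted at r had positive probability, connectedness would have
   probability one, which is excluded below the critical intensity. *)

Require Import Defs.
From HB Require Import structures.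
From mathcomp Require Import all_boot all_order all_algebra.
From mathcomp Require Import ring lra.
From mathcomp Require finmap.
From mathcomp Require Import all_classical all_reals all_analysis.

Set Implicit Arguments.
Unset Strict Implicit.
Unset Printing Implicit Defensive.

Import Order.TTheory GRing.Theory Num.Theory.
Import numFieldNormedType.Exports.

Local Open Scope classical_set_scope.
Local Open Scope ring_scope.

(** * Lorentz geometry *)

Section HyperbolicFunctions.
Context {R : realType}.
Implicit Types a b c s t : R.

Definition cosh s : R := (expR s + expR (- s)) / 2.
Definition sinh s : R := (expR s - expR (- s)) / 2.

Lemma expRVN s : expR s * expR (- s) = 1.
Proof. by rewrite expRN divff// gt_eqF// expR_gt0. Qed.

Lemma cosh2 s : cosh s ^+ 2 = 1 + sinh s ^+ 2.
Proof. by rewrite /cosh /sinh; have := expRVN s; nra. Qed.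

Lemma cosh_ge1 s : 1 <= cosh s.
Proof.
have := cosh2 s; have : 0 < cosh s by rewrite divr_gt0// addr_gt0// expR_gt0.
by nra.
Qed.

Lemma cosh0 : cosh 0 = 1.
Proof. by rewrite /cosh oppr0 expR0; lra. Qed.

Lemma sinh0 : sinh 0 = 0.
Proof. by rewrite /sinh oppr0 expR0 subrr mul0r. Qed.

Lemma coshN s : cosh (- s) = cosh s.
Proof. by rewrite /cosh opprK addrC. Qed.

Lemma sinh_ge0 s : 0 <= s -> 0 <= sinh s.
Proof.
by move=> s0; rewrite divr_ge0// subr_ge0 ler_expR; lra.
Qed.

Lemma sinh_eq0 s : sinh s = 0 -> s = 0.
Proof.
move=> h; have : expR s = expR (- s) by move: h; rewrite /sinh; lra.
by move/expR_inj; lra.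
Qed.

Lemma coshB s t : cosh (s - t) = cosh s * cosh t - sinh s * sinh t.
Proof.
rewrite /cosh /sinh opprB !expRD; have := expRVN s; have := expRVN t.
set a := expR s; set b := expR (- s); set a' := expR t; set b' := expR (- t).
by move=> _ _; field.
Qed.

Lemma arcosh_cosh s : arcosh (cosh s) = `|s|.
Proof.
wlog s0 : s / 0 <= s.
  move=> h; have [/h//|s0] := leP 0 s.
  by rewrite -coshN -normrN; apply: h; lra.
rewrite /arcosh cosh2 [_ - 1]addrC addKr sqrtr_sqr !ger0_norm ?sinh_ge0//.
rewrite -[RHS](expRK s); congr ln; rewrite /cosh /sinh; lra.
Qed.

Lemma cosh_arcosh c : 1 <= c -> cosh (arcosh c) = c.
Proof.
move=> c1; rewrite /cosh /arcosh.
have s0 := sqrtr_ge0 (c ^+ 2 - 1).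
have ss : Num.sqrt (c ^+ 2 - 1) ^+ 2 = c ^+ 2 - 1 by rewrite sqr_sqrtr//; nra.
rewrite expRN lnK ?posrE; last by lra.
set t := Num.sqrt _ in s0 ss *.
have ct : c + t != 0 by rewrite gt_eqF//; lra.
have -> : (c + t)^-1 = c - t.
  by apply: (mulfI ct); rewrite divff//; nra.
by lra.
Qed.

Lemma cosh_le s t : 0 <= s -> s <= t -> cosh s <= cosh t.
Proof.
move=> s0 st; rewrite /cosh.
have h1 : expR s <= expR t by rewrite ler_expR.
have h2 : 1 <= expR s by rewrite -expR0 ler_expR.
have e1 := expRVN s; have e2 := expRVN t.
have p1 := expR_gt0 (- s); have p2 := expR_gt0 (- t).
(* This product expands to 2 ([cosh t] - [cosh s]). *)
suff : 0 <= (expR t - expR s) * (1 - expR (- s) * expR (- t)) by nra.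
rewrite mulr_ge0 ?subr_ge0//.
by rewrite -expRD -expR0 ler_expR; lra.
Qed.

Lemma cosh_lt s t : 0 <= s -> 0 <= t -> cosh s < cosh t -> s < t.
Proof. by move=> s0 t0; apply: contraTT; rewrite -!leNgt; exact: cosh_le. Qed.

End HyperbolicFunctions.

(** * Positivity of the Lorentz form on tangent spaces *)

Section Minkowski.
Context {R : realType} {d : nat}.
Implicit Types (x y p q : hyp R d) (v w : 'rV[R]_d.+1).

Lemma lorentzNl v w : lorentz (- v) w = - lorentz v w.
Proof. by rewrite -scaleN1r lorentzZl mulN1r. Qed.

Lemma lorentzNr v w : lorentz v (- w) = - lorentz v w.
Proof. by rewrite lorentzC lorentzNl lorentzC. Qed.

Definition lorentzE := (@lorentzDl R d, @lorentzDr R d, @lorentzZl R d,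
  @lorentzZr R d, lorentzNl, lorentzNr).

Definition spatial v w : R :=
  \sum_(i < d) v 0 (lift ord0 i) * w 0 (lift ord0 i).

Lemma lorentz_spatial v w : lorentz v w = - (v 0 0 * w 0 0) + spatial v w.
Proof. by []. Qed.

Lemma spatial_ge0 v : 0 <= spatial v v.
Proof. by apply: sumr_ge0 => i _; rewrite -expr2 sqr_ge0. Qed.

Lemma spatial_eq0 v : spatial v v = 0 -> forall i, v 0 (lift ord0 i) = 0.
Proof.
move=> /eqP; rewrite psumr_eq0; last by move=> k _; rewrite -expr2 sqr_ge0.
move=> /allP h i; have := h i (mem_index_enum i).
by rewrite /= mulf_eq0 orbb => /eqP.
Qed.

Lemma spatial_CS v w : spatial v w ^+ 2 <= spatial v v * spatial w w.
Proof.
apply: quad_disc => s t.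
have := spatial_ge0 (s *: v + t *: w); congr (0 <= _).
rewrite /spatial !mulr_suml mulr_sumr !mulr_suml -!big_split /=.
by apply: eq_bigr => i _; rewrite !mxE; ring.
Qed.

(** Orthogonality gives [spatial v p] = v_0 p_0, and [spatial p p] = p_0^2 - 1, so Cauchy-Schwarz on
    the space coordinates yields the bound. It makes the Lorentz form positive definite on the
    tangent space at [p]. *)
Lemma tangent_spatial p v : lorentz v p = 0 ->
  spatial v v <= (p : 'rV_d.+1) 0 0 ^+ 2 * lorentz v v.
Proof.
move=> vp; have := spatial_CS v p; have := lorentz_self p.
move: vp; rewrite !lorentz_spatial => vp pp.
have -> : spatial v p = v 0 0 * (p : 'rV_d.+1) 0 0 by lra.
have -> : spatial p p = (p : 'rV_d.+1) 0 0 ^+ 2 - 1 by lra.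
by nra.
Qed.

Lemma tangent_ge0 p v : lorentz v p = 0 -> 0 <= lorentz v v.
Proof.
move=> /tangent_spatial h; have := le_trans (spatial_ge0 v) h.
by rewrite pmulr_rge0// exprn_gt0// time_gt0.
Qed.

Lemma tangent_eq0 p v : lorentz v p = 0 -> lorentz v v = 0 -> v = 0.
Proof.
move=> vp vv; have := tangent_spatial vp; rewrite vv mulr0 => s0.
have {}s0 : spatial v v = 0 by apply/eqP; rewrite eq_le s0 spatial_ge0.
have v0 : v 0 0 = 0.
  by move: vv; rewrite lorentz_spatial s0; nra.
apply/rowP => i; rewrite mxE; case: (unliftP ord0 i) => [j ->|->//].
exact: spatial_eq0.
Qed.

Lemma tangent_CS p v w : lorentz v p = 0 -> lorentz w p = 0 ->
  lorentz v w ^+ 2 <= lorentz v v * lorentz w w.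
Proof.
move=> vp wp; apply: quad_disc => s t.
have := @tangent_ge0 p (s *: v + t *: w).
rewrite !lorentzE vp wp !mulr0 addr0 (lorentzC w v) => /(_ erefl).
by congr (0 <= _); ring.
Qed.

(** If [v] were on the lower sheet, [- v] would be a point of the hyperboloid and [lorentz_ge1]
    would make [lorentz v p] positive. *)
Lemma timelike_future v p : lorentz v v = -1 -> lorentz v p < 0 -> 0 < v 0 0.
Proof.
move=> vv vp; rewrite ltNge; apply/negP => v0.
have vv' : v 0 0 ^+ 2 = 1 + spatial v v.
  by move: vv; rewrite lorentz_spatial; lra.
have hP : (0 < (- v) 0 0) && (lorentz (- v) (- v) == -1).
  rewrite !lorentzE opprK vv eqxx andbT mxE.
  by have := spatial_ge0 v; nra.
by have := lorentz_ge1 (Hyp hP) p; rewrite /= lorentzNl; lra.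
Qed.

Lemma mdist_cosh x y : cosh (mdist x y) = - lorentz x y.
Proof. by rewrite cosh_arcosh// lorentz_ge1. Qed.

Lemma mdist_arcosh x y s : - lorentz x y = cosh s -> mdist x y = `|s|.
Proof. by rewrite /mdist/= /hdist => ->; exact: arcosh_cosh. Qed.

Lemma lorentz_mdist x y s : lorentz x y = - cosh s -> mdist x y = `|s|.
Proof. by move=> h; apply: mdist_arcosh; rewrite h opprK. Qed.

End Minkowski.

(** * Reflections exchanging two points *)

Section Reflection.
Context {R : realType} {d : nat}.
Implicit Types x y z p q : hyp R d.

(* The reflection in the hyperplane orthogonal to p - q; for p = q the *)
(* division by 0 makes it the identity.                                 *)
Definition reflect_row p q (v : 'rV[R]_d.+1) : 'rV[R]_d.+1 :=
  v + ((lorentz v p - lorentz v q) / (1 + lorentz p q)) *: (hval p - hval q).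

Lemma lorentz_reflect_row p q v w :
  lorentz (reflect_row p q v) (reflect_row p q w) = lorentz v w.
Proof.
rewrite /reflect_row !lorentzE !lorentz_self.
rewrite (lorentzC p w) (lorentzC q w) (lorentzC q p).
have [e|n0] := eqVneq (1 + lorentz p q) 0.
  by rewrite e invr0 !mulr0 !mul0r !addr0.
by field.
Qed.

Lemma reflect_row_swap p q : reflect_row p q p = hval q.
Proof.
rewrite /reflect_row lorentz_self.
have [e|n0] := eqVneq (1 + lorentz p q) 0.
  rewrite e invr0 mulr0 scale0r addr0.
  suff -> : p = q by [].
  apply: (@mdist_positivity _ (hyp R d)).
  by rewrite (@lorentz_mdist _ _ _ _ 0) ?normr0// cosh0; lra.
have -> : (-1 - lorentz p q) / (1 + lorentz p q) = -1 by field.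
by rewrite scaleN1r opprB addrC subrK.
Qed.

Lemma reflect_rowK p q : involutive (reflect_row p q).
Proof.
move=> v; rewrite {1}/reflect_row.
rewrite {2 3}/reflect_row !lorentzE !lorentz_self (lorentzC q p).
rewrite /reflect_row -addrA -scalerDl.
rewrite [X in X *: _](_ : _ = 0) ?scale0r ?addr0//.
have [e|n0] := eqVneq (1 + lorentz p q) 0.
  by rewrite e invr0 !mulr0 addr0.
by field.
Qed.

Lemma reflect_subproof p q x :
  (0 < reflect_row p q x 0 0) &&
  (lorentz (reflect_row p q x) (reflect_row p q x) == -1).
Proof.
have e : lorentz (reflect_row p q x) (reflect_row p q x) = -1.
  by rewrite lorentz_reflect_row lorentz_self.
rewrite e eqxx andbT; apply: (@timelike_future _ _ _ q) => //.
rewrite -(reflect_row_swap p q) lorentz_reflect_row.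
by have := lorentz_ge1 x p; lra.
Qed.

Definition reflection p q x : hyp R d := Hyp (reflect_subproof p q x).

Lemma reflectionK p q : involutive (reflection p q).
Proof. by move=> x; apply: val_inj; exact: reflect_rowK. Qed.

Lemma reflection_swap p q : reflection p q p = q.
Proof. by apply: val_inj; exact: reflect_row_swap. Qed.

(** The mirror consists of the points equidistant from [p] and [q]. A reflection between two points
    at the same distance from the origin can thus stand in for a rotation about the origin. *)
Lemma reflection_fix p q z : mdist z p = mdist z q -> reflection p q z = z.
Proof.
move=> h; apply: val_inj; rewrite /= /reflect_row.
have -> : lorentz z p = lorentz z q.
  by apply: oppr_inj; rewrite -!mdist_cosh h.
by rewrite subrr mul0r scale0r addr0.
Qed.

Lemma mdist_reflection p q x y :
  mdist (reflection p q x) (reflection p q y) = mdist x y.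
Proof. by rewrite /mdist/= /hdist /= lorentz_reflect_row. Qed.

End Reflection.

(** * Parametrized geodesics *)

Section Geodesics.
Context {R : realType} {d : nat}.
Implicit Types (x y z p q : hyp R d) (v w : 'rV[R]_d.+1).

(** The combination lies on the hyperboloid as soon as [v] is a unit tangent vector at [p]; the
    default value of [insubd] makes the function total. *)
Definition geodesic p v (s : R) : hyp R d :=
  insubd p (cosh s *: hval p + sinh s *: v).

Definition unit_tangent p v := lorentz v p = 0 /\ lorentz v v = 1.

Lemma geodesicE p v s : unit_tangent p v ->
  hval (geodesic p v s) = cosh s *: hval p + sinh s *: v.
Proof.
move=> [vp vv]; rewrite /geodesic.
have e : lorentz (cosh s *: hval p + sinh s *: v)
    (cosh s *: hval p + sinh s *: v) = -1.
  rewrite !lorentzE lorentz_self (lorentzC p v) vp vv.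
  by have := cosh2 s; nra.
apply: insubdK.
rewrite -topredE /= e eqxx andbT; apply: (@timelike_future _ _ _ p) => //.
rewrite !lorentzE lorentz_self vp; have := cosh_ge1 s; lra.
Qed.

Lemma geodesic_isometric p v : unit_tangent p v ->
  forall s t, mdist (geodesic p v s) (geodesic p v t) = `|s - t|.
Proof.
move=> pv s t; apply: lorentz_mdist; rewrite !geodesicE//.
case: pv => vp vv; rewrite !lorentzE lorentz_self (lorentzC p v) vp vv coshB.
by ring.
Qed.

Lemma geodesic0 p v : unit_tangent p v -> geodesic p v 0 = p.
Proof.
move=> pv; apply: val_inj; rewrite /= geodesicE//.
by rewrite cosh0 sinh0 scale1r scale0r addr0.
Qed.

Lemma geodesic_through x y : x <> y ->
  exists2 v, unit_tangent x v & geodesic x v (mdist x y) = y.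
Proof.
move=> xy; have t0 : 0 < mdist x y by rewrite mdist_gt0; apply/eqP.
set t := mdist x y in t0 *.
have s0 : sinh t != 0 by apply/eqP => /sinh_eq0; lra.
have c2 := cosh2 t; have lxy := mdist_cosh x y.
have pv : unit_tangent x ((sinh t)^-1 *: (hval y - cosh t *: hval x)).
  split; rewrite !lorentzE !lorentz_self (lorentzC y x) -/t in lxy *.
    by rewrite (_ : lorentz x y = - cosh t); [ring|lra].
  rewrite (_ : lorentz x y = - cosh t); last by lra.
  transitivity ((sinh t)^-1 ^+ 2 * (cosh t ^+ 2 - 1)); first by ring.
  by rewrite c2 addrC addKr -exprMn mulVf// expr1n.
exists ((sinh t)^-1 *: (hval y - cosh t *: hval x)) => //.
apply: val_inj; rewrite /= geodesicE// scalerA divff// scale1r.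
by rewrite addrC subrK.
Qed.

(** The direction [v] is read off from [gamma 0] and [gamma 1]. All products of [gamma t] with
    [gamma 0] and [v] are then known, so the difference between [gamma t] and the geodesic is
    orthogonal to [gamma 0] and has norm 0; it vanishes because the form is definite there. *)
Lemma isometric_geodesic (gamma : R -> hyp R d) :
  (forall s t, mdist (gamma s) (gamma t) = `|s - t|) ->
  exists2 v, unit_tangent (gamma 0) v & gamma = geodesic (gamma 0) v.
Proof.
move=> h; set p := gamma 0.
have L s t : lorentz (gamma s) (gamma t) = - cosh (s - t).
  have := mdist_cosh (gamma s) (gamma t); rewrite h.
  by case: (ger0P (s - t)) => _; rewrite ?coshN => e; lra.
have c1 : sinh (1 : R) != 0 by apply/eqP => /sinh_eq0; lra.
have [v pv g1] : exists2 v, unit_tangent p v & geodesic p v 1 = gamma 1.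
  have [|v pv e] := @geodesic_through p (gamma 1).
    by move=> /(congr1 (mdist p)); rewrite mdistxx h sub0r normrN normr1; lra.
  by exists v => //; move: e; rewrite h sub0r normrN normr1.
exists v => //; apply/funext => t; apply: val_inj; rewrite /= geodesicE//.
have vE : v = (sinh 1)^-1 *: (hval (gamma 1) - cosh 1 *: hval p).
  by rewrite -g1 geodesicE// addrC addKr scalerA mulVf// scale1r.
case: pv => vp vv.
have vt : lorentz v (gamma t) = sinh t.
  rewrite vE !lorentzE !L sub0r coshN coshB; apply: (mulfI c1).
  by rewrite mulrA divff// mul1r; ring.
apply/eqP; rewrite -subr_eq0; apply/eqP; apply: (@tangent_eq0 _ _ p).
  rewrite !lorentzE lorentz_self vp L subr0; ring.
rewrite !lorentzE !lorentz_self (lorentzC (gamma t) v) (lorentzC p v).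
rewrite (lorentzC p (gamma t)) vp vv vt L subr0.
by have := cosh2 t; nra.
Qed.

End Geodesics.

(** * Topology of hyperbolic space *)

Lemma sum_cvg {R : realType} {T : Type} (F : set_system T) {FF : Filter F} (I : Type) (r : seq I)
    (f : I -> T -> R) (l : I -> R) : (forall i, f i @ F --> l i) ->
  (fun z => \sum_(i <- r) f i z) @ F --> \sum_(i <- r) l i.
Proof.
by move=> h; apply: cvg_big => [|i _]; [exact: add_continuous|exact: h].
Qed.

Section HypTopology.
Context {R : realType} {d : nat}.
Notation H := (hyp R d).
Implicit Types (x y z p q : H) (v w : 'rV[R]_d).

Lemma nbhs_hypP x (A : set H) :
  nbhs x A <-> exists2 e : R, 0 < e & forall y, mdist x y < e -> A y.
Proof.
by split => /metricType_numDomainType.nbhs_mdistP [e e0 h]; exists e.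
Qed.

Lemma open_hypP (A : set H) : open A <->
  forall x, A x -> exists2 e : R, 0 < e & forall y, mdist x y < e -> A y.
Proof.
rewrite openE; split=> h x /h; first by move/nbhs_hypP.
by move=> ?; apply/nbhs_hypP.
Qed.

Lemma closed_hball x r : closed (hball x r).
Proof.
rewrite -openC; apply/open_hypP => y /= /negP; rewrite -ltNge => h.
exists (mdist x y - r); first lra.
move=> z yz /=; rewrite /hball/=; have := metric_triangle x z y.
by rewrite (metric_sym z y); lra.
Qed.

(** The upper sheet as a graph over its space coordinates. The chart carries compactness and
    separability over from Euclidean space. *)
Definition chart v : 'rV[R]_d.+1 := \row_i
  (if unlift ord0 i is Some j then v 0 j
   else Num.sqrt (1 + \sum_(j < d) v 0 j ^+ 2)).

Lemma chart_time v : chart v 0 0 = Num.sqrt (1 + \sum_(j < d) v 0 j ^+ 2).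
Proof. by rewrite mxE unlift_none. Qed.

Lemma chart_space v j : chart v 0 (lift ord0 j) = v 0 j.
Proof. by rewrite mxE liftK. Qed.

Lemma chart_subproof v :
  (0 < chart v 0 0) && (lorentz (chart v) (chart v) == -1).
Proof.
have s0 : 0 <= \sum_(j < d) v 0 j ^+ 2 by apply: sumr_ge0 => j _; rewrite sqr_ge0.
rewrite chart_time sqrtr_gt0; apply/andP; split; first lra.
rewrite /lorentz chart_time -expr2 sqr_sqrtr; last lra.
under [X in _ + X]eq_bigr do rewrite chart_space -expr2.
by rewrite opprD -addrA addNr addr0.
Qed.

Definition hchart v : H := Hyp (chart_subproof v).

Definition coords x : 'rV[R]_d := \row_j (x : 'rV[R]_d.+1) 0 (lift ord0 j).

Lemma coordsK : cancel coords hchart.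
Proof.
move=> x; apply: val_inj; apply/rowP => i /=.
case: (unliftP ord0 i) => [j ->|->]; first by rewrite chart_space mxE.
rewrite chart_time; have t0 := time_gt0 x; have := lorentz_self x.
rewrite lorentz_spatial => e.
rewrite (eq_bigr (fun j => hval x 0 (lift ord0 j) * hval x 0 (lift ord0 j))).
  rewrite -/(spatial x x) (_ : 1 + _ = hval x 0 0 ^+ 2); last first.
    by rewrite expr2; lra.
  by rewrite sqrtr_sqr gtr0_norm.
by move=> j _; rewrite mxE expr2.
Qed.

Lemma lorentz_cvg {T : Type} (F : set_system T) {FF : Filter F}
    (f : T -> 'rV[R]_d.+1) (u l : 'rV[R]_d.+1) :
  (forall i, f t 0 i @[t --> F] --> l 0 i) ->
  - lorentz u (f t) @[t --> F] --> - lorentz u l.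
Proof.
move=> h; apply: cvgN; apply: cvgD.
  by apply: cvgN; apply: cvgM; [exact: cvg_cst|exact: h].
by apply: sum_cvg => j; apply: cvgM; [exact: cvg_cst|exact: h].
Qed.

Lemma chart_cvg {T : Type} (F : set_system T) {FF : Filter F}
    (f : T -> 'rV[R]_d) (l : 'rV[R]_d) :
  (forall j, f t 0 j @[t --> F] --> l 0 j) ->
  forall i, chart (f t) 0 i @[t --> F] --> chart l 0 i.
Proof.
move=> h i; case: (unliftP ord0 i) => [j ->|->].
  by rewrite chart_space; under eq_cvg do rewrite chart_space; exact: h.
rewrite chart_time; under eq_cvg do rewrite chart_time.
have c : 1 + \sum_(j < d) f t 0 j ^+ 2 @[t --> F] --> 1 + \sum_(j < d) l 0 j ^+ 2.
  apply: cvgD; first exact: cvg_cst.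
  by apply: sum_cvg => j; apply: cvgM; exact: h.
exact: (cvg_comp _ _ c (@sqrt_continuous R _)).
Qed.

(** A distance is below [e] exactly when its [cosh], minus the Lorentz product, is below [cosh e].
    That product is continuous in the coordinates and equals 1 < [cosh e] on the diagonal. *)
Lemma hchart_continuous : continuous hchart.
Proof.
move=> v; apply: (metricType_numDomainType.cvgrPdist_lt (F := nbhs v) _ _).2.
move=> e e0.
have c : - lorentz (hchart v) (hchart w) @[w --> v] -->
    - lorentz (hchart v) (hchart v).
  apply: (@lorentz_cvg _ (nbhs v) _ chart) => i.
  by apply: (@chart_cvg _ (nbhs v) _ id) => j; exact: coord_continuous.
rewrite lorentz_self opprK in c.
have ce : (1 : R) < cosh e.
  have := cosh2 e; have : sinh e != 0 by apply/eqP => /sinh_eq0; lra.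
  move=> s0; have : 0 < sinh e ^+ 2 by rewrite exprn_even_gt0.
  by have := cosh_ge1 e; nra.
have /(_ (nbhs_filter _)) := cvgr_lt _ c _ ce.
apply: (@filterS _ (nbhs v) (nbhs_filter _)) => w h.
by apply: cosh_lt; rewrite ?mdist_ge0 ?mdist_cosh// ltW.
Qed.

Lemma compact_hball x r : compact (hball x r).
Proof.
suff c s : compact (hball (origin R d) s).
  apply: (subclosed_compact (@closed_hball x r) (c (mdist (origin R d) x + r))).
  by move=> y; rewrite /hball/=; have := metric_triangle (origin R d) x y; lra.
have [s0|s0] := ltP s 0.
  have -> : hball (origin R d) s = set0.
    apply/seteqP; split => // y; rewrite /hball/=.
    by have := mdist_ge0 (origin R d) y; lra.
  exact: compact0.
(* A space coordinate is bounded by the time coordinate, which is [cosh] of the distance to the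
   origin. The ball is therefore a closed subset of the chart image of this cube. *)
pose K := [set v : 'rV[R]_d | forall j, (`[- cosh s, cosh s]%classic : set R) (v 0 j)].
have cK : compact K.
  by apply: (@rV_compact R d (fun=> `[- cosh s, cosh s]%classic)) => j; exact: segment_compact.
apply: (subclosed_compact (@closed_hball _ s) (continuous_compact _ cK)).
  exact/continuous_subspaceT/hchart_continuous.
move=> y ys; exists (coords y); last exact: coordsK.
move=> j /=; rewrite mxE in_itv/= -ler_norml.
have : hval y 0 0 <= cosh s.
  have /= := @cosh_le _ _ s (mdist_ge0 (origin R d) y) ys.
  rewrite mdist_cosh /lorentz /= !mxE big1; first by rewrite /=; lra.
  by move=> i _; rewrite !mxE/= mul0r.
apply: le_trans; rewrite -sqrtr_sqr -[leRHS]gtr0_norm ?time_gt0// -sqrtr_sqr.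
rewrite ler_sqrt ?sqr_ge0//.
have := lorentz_self y; rewrite /lorentz (bigD1 j)//=.
set S := \sum_(i < d | _) _; have : 0 <= S.
  by apply: sumr_ge0 => i _; rewrite -expr2 sqr_ge0.
by rewrite !expr2; lra.
Qed.

Lemma hyp_separable : exists f : nat -> H,
  forall x (e : R), 0 < e -> exists i, mdist x (f i) < e.
Proof.
(* The sequence enumerates the chart images of the rational vectors; integers that code no vector go
   to the origin. *)
exists (fun i : nat => if (unpickle i : option 'rV[rat]_d) is Some r
  then hchart (map_mx ratr r) else origin R d).
move=> x e e0; rewrite -(coordsK x).
have : \forall w \near coords x, mdist (hchart (coords x)) (hchart w) < e.
  exact: (metricType_numDomainType.cvgrPdist_lt (F := nbhs (coords x)) _ _).1
    (@hchart_continuous _) _ e0.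
move=> /nbhs_ballP[b /= b0 hb].
have /choice[r hr] : forall j, exists r : rat,
    coords x 0 j - b < ratr r < coords x 0 j + b.
  move=> j; have [|r] := @rat_in_itvoo R (coords x 0 j - b) (coords x 0 j + b).
    by lra.
  by rewrite in_itv => ?; exists r.
exists (pickle (\row_j r j)); rewrite pickleK; apply: hb.
split=> // i j; rewrite (ord1 i) /ball/= !mxE.
by have := hr j; rewrite mxE ltr_norml; lra.
Qed.

End HypTopology.

(** * Geodesic lines and cylinders *)

Section Lines.
Context {R : realType} {d : nat}.
Notation H := (hyp R d).
Implicit Types (x y z p q : H) (v w : 'rV[R]_d.+1) (L : set H).

Lemma mdist_lip x y z : `|mdist x y - mdist x z| <= mdist y z.
Proof.
have := metric_triangle x y z; have := metric_triangle x z y.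
by rewrite (metric_sym z y) ler_norml; lra.
Qed.

Lemma geodesic_linesP L : geodesic_lines L <->
  exists p v, unit_tangent p v /\ L = range (geodesic p v).
Proof.
split=> [[g hg ->]|[p [v [pv ->]]]].
  have [v pv e] := isometric_geodesic hg.
  by exists (g 0), v; split=> //; rewrite -e.
by exists (geodesic p v) => //; exact: geodesic_isometric.
Qed.

Lemma isometric_continuous (g : R -> H) :
  (forall s t, mdist (g s) (g t) = `|s - t|) -> continuous g.
Proof.
move=> hg s; apply: (metricType_numDomainType.cvgrPdist_lt (F := nbhs s) _ _).2.
move=> e e0; apply/nbhs_ballP; exists e => // t.
by rewrite /ball/= hg.
Qed.

(** An attained distance turns the infimum in [cylinder] into the existence of a point of the
    line. *)
Lemma nearest_point L x : geodesic_lines L ->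
  exists2 y, L y & forall z, L z -> mdist x y <= mdist x z.
Proof.
case=> g hg ->; pose f s := mdist x (g s).
have flip s t : `|f s - f t| <= `|s - t| by rewrite -hg; exact: mdist_lip.
have cf : continuous f.
  move=> s; apply: (@cvgrPdist_lt _ _ _ (nbhs s) _ _ _).2 => e e0.
  apply/nbhs_ballP; exists e => // t; rewrite /ball/=.
  exact: le_lt_trans (flip _ _).
have f0 : 0 <= f 0 by exact: mdist_ge0.
(* Outside this interval the triangle inequality through [g 0] gives a distance of at least [f 0],
   so the minimum over the interval is global. *)
have [||c cM hc] := @EVT_min R f (- (2 * f 0)) (2 * f 0).
- by lra.
- exact: continuous_subspaceT.
exists (g c) => [|_ [s _ <-]]; first by exists c.
have [sM|] := boolP (s \in `[- (2 * f 0), 2 * f 0]); first exact: hc.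
rewrite in_itv/= -ler_norml -ltNge => sM.
apply: (@le_trans _ _ (f 0)); first by apply: hc; rewrite in_itv/=; lra.
have := metric_triangle (g s) x (g 0); rewrite hg subr0 (metric_sym (g s)) -/(f s) -/(f 0).
by rewrite -/(f s); lra.
Qed.

Lemma cylinderP L x : geodesic_lines L ->
  cylinder L x <-> exists2 y, L y & mdist x y <= 1.
Proof.
move=> hL; have [y Ly hy] := nearest_point x hL.
have lb : has_lbound [set mdist x y | y in L].
  by exists 0 => _ [z _ <-]; exact: mdist_ge0.
split=> [h|[z Lz xz]]; last first.
  by apply: le_trans xz; apply: ge_inf => //; exists z.
exists y => //; apply: le_trans h; apply: lb_le_inf.
  by exists (mdist x y), y.
by move=> _ [z Lz <-]; exact: hy.
Qed.

Lemma line_sub_cylinder L : geodesic_lines L -> L `<=` cylinder L.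
Proof. by move=> hL x Lx; apply/cylinderP => //; exists x; rewrite ?mdistxx. Qed.

(** The distance to a line is attained, so missing a closed ball leaves room for a larger one.
    Closedness of cylinders and the later limit arguments rest on this. *)
Lemma line_miss_hball L x r : geodesic_lines L -> ~ (L `&` hball x r !=set0) ->
  exists2 e, 0 < e & ~ (L `&` hball x (r + e) !=set0).
Proof.
move=> hL h; have [y Ly hy] := nearest_point x hL.
have ry : r < mdist x y by rewrite ltNge; apply/negP => ?; apply: h; exists y.
exists ((mdist x y - r) / 2); first lra.
by move=> [z [Lz]]; rewrite /hball/=; have := hy z Lz; lra.
Qed.

Lemma closed_cylinder L : geodesic_lines L -> closed (cylinder L).
Proof.
move=> hL; rewrite -openC; apply/open_hypP => x /= Lx.
have [|e e0 he] := @line_miss_hball L x 1 hL.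
  by move=> [y [Ly xy]]; apply: Lx; apply/cylinderP => //; exists y.
exists e => // z xz /(cylinderP _ hL)[y Ly zy]; apply: he; exists y; split=> //.
by rewrite /hball/=; have := metric_triangle x z y; lra.
Qed.

Lemma segment_path x y : exists2 S : set H, connected S &
  [/\ S x, S y & forall z, S z -> mdist z y <= mdist x y].
Proof.
have [->|/eqP xy] := eqVneq x y.
  exists [set y]; first exact: connected1.
  by split=> // z ->.
have [v pv e] := geodesic_through xy.
exists (geodesic x v @` `[0, mdist x y]).
  apply: connected_continuous_connected; first exact: segment_connected.
  exact/continuous_subspaceT/isometric_continuous/geodesic_isometric.
split.
- by exists 0; [rewrite /= in_itv/= lexx mdist_ge0|exact: geodesic0].
- by exists (mdist x y) => //; rewrite /= in_itv/= lexx mdist_ge0.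
- move=> _ [s /= + <-]; rewrite in_itv/= => ?.
  by rewrite -[X in mdist _ X]e geodesic_isometric// ler_norml; lra.
Qed.

Lemma connected_line L : geodesic_lines L -> connected L.
Proof.
move=> [g hg ->]; apply: connected_continuous_connected.
  exact/connected_intervalP.
exact/continuous_subspaceT/isometric_continuous.
Qed.

Lemma line_nonempty L : geodesic_lines L -> L !=set0.
Proof. by move=> [g _ ->]; exists (g 0), 0. Qed.

(** The cylinder is the union, over its points, of the line together with a segment from the point
    to the line; all these connected sets share the line. *)
Lemma connected_cylinder L : geodesic_lines L -> connected (cylinder L).
Proof.
move=> hL; have [p Lp] := line_nonempty hL.
have /choice[S hS] : forall x, exists S : set H, cylinder L x ->
    [/\ connected S, S x, S `<=` cylinder L & L `<=` S].
  move=> x; have [Cx|] := pselect (cylinder L x); last by exists set0.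
  have /(cylinderP _ hL)[y Ly xy] := Cx.
  have [S cS [Sx Sy h]] := segment_path x y.
  exists (S `|` L) => _; split; first 1 last.
  - by left.
  - move=> z [/h zy|]; last exact: line_sub_cylinder.
    by apply/cylinderP => //; exists y => //; exact: le_trans xy.
  - by move=> z; right.
  - apply: connectedU => //; last exact: connected_line.
    by exists y.
have -> : cylinder L = \bigcup_(x in cylinder L) S x.
  apply/seteqP; split => [x Cx|x [y Cy Sx]].
    by exists x => //; case: (hS x Cx).
  by case: (hS y Cy) => _ _ + _; apply.
apply: bigcup_connected.
  by exists p => x Cx; case: (hS x Cx) => _ _ _; apply.
by move=> x Cx; case: (hS x Cx).
Qed.

Lemma line_unbounded L x r : geodesic_lines L -> ~ (L `<=` hball x r).
Proof.
move=> [g hg ->] h.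
have h0 : hball x r (g 0) by apply: h; exists 0.
have h1 : hball x r (g (1 + 2 * `|r|)) by apply: h; exists (1 + 2 * `|r|).
have := metric_triangle (g (1 + 2 * `|r|)) x (g 0).
rewrite hg subr0 (metric_sym (g _)) ger0_norm; last by have := normr_ge0 r; lra.
move: h0 h1; rewrite /hball/=; have := ler_norm r; lra.
Qed.

Lemma line_through L x y : geodesic_lines L -> L x -> L y -> x <> y ->
  L = range (geodesic x ((sinh (mdist x y))^-1 *:
        (hval y - cosh (mdist x y) *: hval x))).
Proof.
move=> [g hg ->] [s _ gs] [t _ gt] xy; set v := _ *: _.
(* The sign [e] orients the line from [x] to [y], so that [f] below starts at [x] and reaches [y] at
   a positive time. *)
have [e e1 te] : exists2 e : R, e * e = 1 & t = s + e * mdist x y.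
  rewrite -gs -gt hg; case: (ltrP s t) => st.
    by exists 1; lra.
  by exists (-1); lra.
pose f r := g (s + e * r).
have ne : `|e| = 1.
  have : `|e| ^+ 2 = 1 by rewrite real_normK ?num_real// expr2.
  by have := normr_ge0 e; nra.
have hf r r' : mdist (f r) (f r') = `|r - r'|.
  rewrite hg (_ : _ - _ = e * (r - r')); last by ring.
  by rewrite normrM ne mul1r.
have f0 : f 0 = x by rewrite /f mulr0 addr0.
have [v' pv' fE] := isometric_geodesic hf; rewrite f0 in pv' fE.
have fy : f (mdist x y) = y by rewrite /f -te.
have s0 : sinh (mdist x y) != 0.
  by apply/eqP => /sinh_eq0 /(@mdist_positivity _ H).
have vE : v = v'.
  rewrite /v -[X in hval X - _]fy fE geodesicE// addrC addKr scalerA mulVf//.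
  by rewrite scale1r.
rewrite vE -fE; apply/seteqP; split => [_ [r _ <-]|_ [r _ <-]].
  exists (e * (r - s)) => //.
  by rewrite /f mulrA e1 mul1r addrC subrK.
by exists (s + e * r).
Qed.

Lemma line_unique L L' x y : geodesic_lines L -> geodesic_lines L' -> x <> y ->
  L x -> L y -> L' x -> L' y -> L = L'.
Proof.
move=> hL hL' xy Lx Ly Lx' Ly'.
by rewrite (line_through hL Lx Ly xy) -(line_through hL' Lx' Ly' xy).
Qed.

Lemma image_line (g : H -> H) L : (forall x y, mdist (g x) (g y) = mdist x y) ->
  geodesic_lines L -> geodesic_lines (g @` L).
Proof.
move=> hg [f hf ->]; exists (g \o f) => [s t|]; first by rewrite /= hg.
by rewrite image_comp.
Qed.

End Lines.

(** * Horocycles and the escape of lines *)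

Section Horocycle.
Context {R : realType} {d : nat}.
Notation H := (hyp R d).
Implicit Types (x y z p q : H) (v w : 'rV[R]_d.+1) (L : set H).

(** If [A] is positive the upper bound limits [s]; if [A] = 0 the expression decays and the lower
    bound does. *)
Lemma exp_escape (A B C : R) : 0 <= A -> 0 <= B -> 0 < A + B -> 0 < C ->
  exists S, forall s, 1 <= C * (A * expR s + B * expR (- s)) ->
    A * expR s + B * expR (- s) <= C -> s <= S.
Proof.
move=> A0 B0 AB C0; have [A00|An0] := eqVneq A 0.
  exists (ln (C * B)) => s h _.
  rewrite -ler_expR lnK ?posrE; last by nra.
  rewrite A00 mul0r add0r in h.
  rewrite -[leLHS]mulr1 (le_trans (ler_wpM2l (expR_ge0 s) h))//.
  rewrite [leLHS](_ : _ = C * B * (expR s * expR (- s))); last by ring.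
  by rewrite expRVN mulr1.
have {}A0 : 0 < A by rewrite lt_neqAle eq_sym An0.
exists (ln (C / A)) => s _ h.
rewrite -ler_expR lnK ?posrE ?divr_gt0// ler_pdivlMr//.
by have := mulr_ge0 B0 (expR_ge0 (- s)); nra.
Qed.

Section NullDirection.
Variable xi : 'rV[R]_d.+1.
Hypothesis xi_null : lorentz xi xi = 0.
Hypothesis xi_future : forall x, lorentz x xi < 0.

(** Write a = <x, y>, b = <y, xi>, c = <x, xi>. Cauchy-Schwarz for the tangent components of [x] and
    [xi] at [y] reads (c + a b)^2 <= (a^2 - 1) b^2, hence - c <= 2 a b. So - <., xi>, the
    exponential of a Busemann function, varies by a bounded factor over bounded distances. *)
Lemma null_bound x y :
  - lorentz x xi <= 2 * (- lorentz x y) * (- lorentz y xi).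
Proof.
have vy : lorentz (hval x + lorentz x y *: hval y) y = 0.
  by rewrite !lorentzE lorentz_self; ring.
have wy : lorentz (xi + lorentz xi y *: hval y) y = 0.
  by rewrite !lorentzE lorentz_self; ring.
have := tangent_CS vy wy.
rewrite !lorentzE !lorentz_self xi_null (lorentzC xi y) (lorentzC y x).
have b0 := xi_future y; have a1 := lorentz_ge1 x y.
set a := lorentz x y in a1 *; set b := lorentz y xi in b0 *.
set c := lorentz x xi => h; rewrite leNgt; apply/negP => c2.
suff : 0 < (c + a * b) ^+ 2 - (a ^+ 2 - 1) * b ^+ 2 by lra.
have e : 0 < - c - a * b - (a * b) by lra.
have f : 0 < a * b by nra.
nra.
Qed.

(** This makes both exponential coefficients of - <., xi> along a geodesic nonnegative. *)
Lemma null_tangent p v : unit_tangent p v ->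
  lorentz v xi ^+ 2 <= lorentz p xi ^+ 2.
Proof.
move=> [vp vv].
have wp : lorentz (xi + lorentz xi p *: hval p) p = 0.
  by rewrite !lorentzE lorentz_self; ring.
have := tangent_CS vp wp.
rewrite !lorentzE !lorentz_self vv vp xi_null (lorentzC xi p).
by nra.
Qed.

(* Along a line - <., xi> is A e^s + B e^-s, so it leaves every compact subset *)
(* of ]0, oo[ at both ends, whereas it is 1 on the horosphere.                 *)
Lemma line_escape L (r : R) : geodesic_lines L ->
  exists M, forall x, lorentz x xi = -1 -> M < mdist (origin R d) x ->
    ~ (L `&` hball x r !=set0).
Proof.
move=> /geodesic_linesP[p [v [pv ->]]].
(* By [null_bound], used in both directions, a point within [r] of the horosphere has - <., xi>
   between 1/C and C. *)
pose C := 2 * cosh `|r|; have C0 : 0 < C by have := cosh_ge1 `|r|; rewrite /C; lra.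
pose A := (- lorentz p xi - lorentz v xi) / 2.
pose B := (- lorentz p xi + lorentz v xi) / 2.
have h := null_tangent pv; have p0 := xi_future p.
have A0 : 0 <= A by rewrite /A; nra.
have B0 : 0 <= B by rewrite /B; nra.
have AB : 0 < A + B by rewrite /A /B; lra.
have [S hS] := exp_escape A0 B0 AB C0.
have [S' hS'] := exp_escape B0 A0 ltac:(lra) C0.
exists (mdist (origin R d) p + Num.max S S' + `|r|) => x x1 xM.
move=> [y [[s _ ys]]]; rewrite /hball/= => xy.
have cr : - lorentz x y <= cosh `|r|.
  rewrite -mdist_cosh; apply: cosh_le; first exact: mdist_ge0.
  by rewrite (le_trans xy)// ler_norm.
have yE : - lorentz y xi = A * expR s + B * expR (- s).
  rewrite -ys geodesicE// !lorentzE /A /B /cosh /sinh; lra.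
have ypos := xi_future y.
have h1 : 1 <= C * (A * expR s + B * expR (- s)).
  rewrite -yE /C; apply: le_trans (_ : 2 * (- lorentz x y) * (- lorentz y xi) <= _).
    by have := null_bound x y; rewrite x1 opprK.
  by rewrite ler_wpM2r; lra.
have h2 : A * expR s + B * expR (- s) <= C.
  have := null_bound y x; rewrite x1 (lorentzC y x) opprK mulr1 -yE /C.
  by lra.
have sS := hS _ h1 h2.
have sS' : - s <= S'.
  by apply: hS'; rewrite opprK addrC.
have : mdist p y <= Num.max S S'.
  rewrite -ys -{1}(geodesic0 pv) geodesic_isometric// sub0r normrN ler_norml.
  rewrite le_max sS orTb andbT lerNl le_max sS' orbT//.
have := metric_triangle (origin R d) p x; have := metric_triangle p y x.
have := ler_norm r; rewrite (metric_sym y x); lra.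
Qed.

End NullDirection.

Lemma lorentz_origin x : lorentz (origin R d) x = - hval x 0 0.
Proof.
rewrite /lorentz /= !mxE big1 ?addr0 ?mul1r// => i _.
by rewrite !mxE /= mul0r.
Qed.

End Horocycle.

(** The null vector [xi] has ones in the time and first space coordinates, so its horosphere passes
    through the origin. Moving along the horosphere takes a second space direction, which [2 <= d]
    provides. *)
Lemma horocycle (R : realType) (d : nat) : (2 <= d)%N -> exists xi : 'rV[R]_d.+1,
  [/\ lorentz xi xi = 0, forall x : hyp R d, lorentz x xi < 0 &
      forall t : R, 0 <= t -> exists2 x : hyp R d, lorentz x xi = -1 & mdist (origin R d) x = t].
Proof.
case: d => [//|[//|d' _]]; pose i1 : 'I_d'.+2 := ord0.
pose i2 : 'I_d'.+2 := lift ord0 ord0.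
pose xi : 'rV[R]_d'.+3 := \row_i ((i == 0) || (i == lift ord0 i1))%:R.
have xiE (v : 'rV[R]_d'.+3) : lorentz v xi = - v 0 0 + v 0 (lift ord0 i1).
  rewrite /lorentz !mxE eqxx mulr1; congr (_ + _).
  rewrite (bigD1 i1)//= mxE eqxx orbT mulr1 big1 ?addr0// => i i1i.
  by rewrite mxE (inj_eq (lift_inj (h := ord0))) (negbTE i1i) mulr0.
exists xi; split.
- by rewrite xiE !mxE eqxx orbT; lra.
- move=> x; rewrite xiE; have := lorentz_self x; have := time_gt0 x.
  rewrite /lorentz (bigD1 i1)//=; set S := \sum_(i < _ | _) _.
  have : 0 <= S by apply: sumr_ge0 => i _; rewrite -expr2 sqr_ge0.
  nra.
(* With space coordinates a, sqrt(2 a), 0, ... the squares sum to (1 + a)^2 - 1. The time coordinate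
   is then 1 + a = [cosh t], and the product with [xi] is a - (1 + a) = -1. *)
- move=> t t0; pose a : R := cosh t - 1.
  have a0 : 0 <= a by have := cosh_ge1 t; rewrite /a; lra.
  pose v : 'rV[R]_d'.+2 := \row_j (if j == i1 then a else
     if j == i2 then Num.sqrt (2 * a) else 0).
  have vE : \sum_(j < d'.+2) v 0 j ^+ 2 = a ^+ 2 + 2 * a.
    rewrite (bigD1 i1)//= (bigD1 i2)//= big1 ?addr0; last first.
      by move=> j /andP[/negbTE j1 /negbTE j2]; rewrite mxE j1 j2 expr0n.
    by rewrite !mxE/= sqr_sqrtr//; lra.
  have tE : hval (hchart v) 0 0 = 1 + a.
    rewrite chart_time vE (_ : 1 + _ = (1 + a) ^+ 2); last by ring.
    by rewrite sqrtr_sqr ger0_norm//; lra.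
  exists (hchart v).
    by rewrite xiE tE chart_space mxE eqxx; lra.
  rewrite -[RHS]ger0_norm//; apply: lorentz_mdist.
  by rewrite lorentz_origin tE /a; lra.
Qed.

(** * Connected components of the occupied set *)

Section Linked.
Context {T : Type}.
Implicit Types (r : T -> T -> Prop) (W : set T) (a b c : T).

Inductive linked r W a : T -> Prop :=
| linked_refl : W a -> linked r W a a
| linked_step b c : linked r W a b -> W c -> r b c -> linked r W a c.

Lemma linked_l r W a b : linked r W a b -> W a.
Proof. by elim. Qed.

Lemma linked_r r W a b : linked r W a b -> W b.
Proof. by case. Qed.

Lemma linked_trans r W a b c : linked r W a b -> linked r W b c -> linked r W a c.
Proof. by move=> ab; elim=> // x y _ ax Wy xy; exact: linked_step ax Wy xy. Qed.

Lemma linked_edge r W a b : W a -> W b -> r a b -> linked r W a b.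
Proof. by move=> Wa Wb; apply: linked_step => //; exact: linked_refl. Qed.

Lemma linked_sym r W a b : (forall x y, r x y -> r y x) ->
  linked r W a b -> linked r W b a.
Proof.
move=> rC; elim=> [|x y ax xa Wy xy]; first exact: linked_refl.
by apply: linked_trans xa; apply: linked_edge => //; [exact: linked_r ax|exact: rC].
Qed.

Lemma linked_mono r r' W W' a b : W `<=` W' ->
  (forall x y, W x -> W y -> r x y -> r' x y) ->
  linked r W a b -> linked r' W' a b.
Proof.
move=> WW' rr'; elim=> [/WW'|x y ax ax' Wy xy]; first exact: linked_refl.
by apply: (linked_step ax'); [exact: WW'|apply: rr' => //; exact: linked_r ax].
Qed.

End Linked.

Lemma linked_image {T U : Type} (f : T -> U) r r' (W : set T) a b :
  (forall x y, r x y -> r' (f x) (f y)) ->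
  linked r W a b -> linked r' (f @` W) (f a) (f b).
Proof.
move=> rr'; elim=> [Wa|x y ax ax' Wy xy]; first by apply: linked_refl; exists a.
by apply: linked_step ax' _ (rr' _ _ xy); exists y.
Qed.

Section Components.
Context {R : realType} {d : nat}.
Notation H := (hyp R d).
Notation o := (origin R d).
Implicit Types (x y z p q : H) (L : set H) (w : line_config R d).

Definition hits L x (r : R) := L `&` hball x r !=set0.

(** For geodesic lines this means that the two cylinders meet, by [cylinder_hits]. *)
Definition touch L L' := exists z, hits L z 1 /\ hits L' z 1.

Lemma touchC L L' : touch L L' -> touch L' L.
Proof. by move=> [z [? ?]]; exists z. Qed.

Lemma config_line w L : val w L -> geodesic_lines L.
Proof. by move: (valP w); rewrite inE => -[+ _]; apply. Qed.

Lemma config_finite w K : compact K -> finite_set (val w `&` lines_hitting K).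
Proof. by move: (valP w); rewrite inE => -[_ +]; apply. Qed.

Lemma cylinder_hits L x : geodesic_lines L -> cylinder L x <-> hits L x 1.
Proof.
by move=> hL; split=> [/(cylinderP x hL)[y]|[y [? ?]]];
  [exists y|apply/cylinderP => //; exists y].
Qed.

Lemma linked_component w L L' x y : linked touch (val w) L L' ->
  cylinder L x -> cylinder L' y -> connected_component (occupied w) x y.
Proof.
have comp M u v : val w M -> cylinder M u -> cylinder M v ->
    connected_component (occupied w) u v.
  move=> wM Mu Mv; apply: (connected_component_max Mu) => //.
    by move=> t Mt; exists M.
  exact: connected_cylinder (config_line wM).
move=> LL' Lx; elim: LL' y => [wL|M M' LM h wM' [z [Mz M'z]]] y My.
  exact: (comp L).
apply: (connected_component_trans (h z _)).
  by apply/(cylinder_hits _ (config_line (linked_r LM))).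
by apply: (comp M') => //; apply/cylinder_hits => //; exact: config_line wM'.
Qed.

Lemma all_linked_connected w :
  (forall L L', val w L -> val w L' -> linked touch (val w) L L') ->
  connected (occupied w).
Proof.
move=> h; have [->|/set0P[x [L wL Lx]]] := eqVneq (occupied w) set0.
  exact: connected0.
suff -> : occupied w = connected_component (occupied w) x.
  exact: component_connected.
apply/seteqP; split; last exact: connected_component_sub.
by move=> y [L' wL' L'y]; apply: linked_component Lx L'y; exact: h.
Qed.

(** Near a point only the cylinders of the lines within distance 2 of it matter, and these are
    finitely many by local finiteness. *)
Lemma closed_bigcup_cylinder w (V : set (set H)) : V `<=` val w ->
  closed (\bigcup_(L in V) cylinder L).
Proof.
move=> Vw y hy.
pose F := V `&` lines_hitting (hball y 2).
have fF : finite_set F.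
  apply: sub_finite_set (config_finite w (@compact_hball R d y 2)).
  by move=> L [/Vw].
suff : closure (\bigcup_(L in F) cylinder L) y.
  have : closed (\bigcup_(L in F) cylinder L).
    apply: closed_bigcup => // L [/Vw wL _].
    by apply: closed_cylinder; exact: config_line wL.
  by move=> cF hF; have [L [VL _] Ly] := cF _ hF; exists L.
move=> B By; have /hy : nbhs y (B `&` ball y 1).
  by apply: filterI => //; exact: nbhsx_ballx.
move=> [z [[L VL Lz] [Bz]]]; rewrite ballEmdist/= => yz; exists z; split=> //.
exists L => //; split=> //; have hL := config_line (Vw _ VL); split=> //.
have /(cylinderP z hL)[u Lu zu] := Lz.
exists u; split=> //; rewrite /hball/=; have := metric_triangle y z u; lra.
Qed.

(** The cylinders linked to [L] and the remaining ones have closed, disjoint unions that cover the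
    occupied set. A connected set that meets the first union stays inside it. *)
Lemma component_linked w L L' x y : val w L -> val w L' ->
  cylinder L x -> cylinder L' y -> connected_component (occupied w) x y ->
  linked touch (val w) L L'.
Proof.
move=> wL wL' Lx L'y [A [Ax AC cA] Ay].
pose U := \bigcup_(M in linked touch (val w) L) cylinder M.
pose V := \bigcup_(M in val w `\` linked touch (val w) L) cylinder M.
have cU : closed U by apply: (@closed_bigcup_cylinder w) => M; exact: linked_r.
have cV : closed V by apply: (@closed_bigcup_cylinder w) => M [].
have UV z : U z -> V z -> False.
  move=> [M LM Mz] [N [wN LN] Nz]; apply: LN.
  have hM := config_line (linked_r LM); have hN := config_line wN.
  by apply: linked_step LM wN _; exists z; split; apply/cylinder_hits.
have occ z : occupied w z -> U z \/ V z.
  move=> [M wM Mz]; have [LM|LM] := pselect (linked touch (val w) L M).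
    by left; exists M.
  by right; exists M.
have : A `&` U = A.
  apply: cA.
  - by exists x; split=> //; exists L => //; exact: linked_refl.
  - exists (~` V); first by rewrite openC.
    apply/seteqP; split => z [Az]; first by move=> Uz; split=> // /(UV z Uz).
    by case: (occ z (AC _ Az)).
  - by exists U.
move=> AU; have [_ [M LM My]] : (A `&` U) y by rewrite AU.
have hM := config_line (linked_r LM); have hL' := config_line wL'.
by apply: linked_step LM wL' _; exists y; split; apply/cylinder_hits.
Qed.

Definition rooted (r : R) w := forall L, val w L ->
  exists2 L', hits L' o r & linked touch (val w) L L'.

(** A line is unbounded, so it lies in one of the finitely many unbounded components. Choosing in
    each of these a point of a line, when there is one, gives finitely many distances to the origin,
    and [n] bounds them. *)
Lemma finite_components_rooted w :
  finite_set (infinite_components (occupied w)) -> exists n : nat, rooted n%:R w.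
Proof.
move=> /finite_seqP[s sE]; pose C x := connected_component (occupied w) x.
have /choice[f hf] : forall D, exists n : nat,
    (exists L x, [/\ val w L, L x & D = C x]) ->
    exists L x, [/\ val w L, L x, D = C x & mdist o x <= n%:R].
  move=> D; have [[L [x [wL Lx DC]]]|] := pselect
    (exists L x, [/\ val w L, L x & D = C x]); last by exists 0%N.
  exists (Num.truncn (mdist o x)).+1 => _; exists L, x; split=> //.
  exact: ltW (truncnS_gt _).
exists (\max_(D <- s) f D)%N => L wL.
have hL := config_line wL; have [x Lx] := line_nonempty hL.
have Cx : occupied w x by exists L => //; exact: line_sub_cylinder.
have : infinite_components (occupied w) (C x).
  split; first by exists x.
  move=> r h; apply: (@line_unbounded _ _ L o r hL) => y Ly; apply: h.
  apply: (linked_component (linked_refl _ wL)); exact: line_sub_cylinder.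
rewrite sE /= => Ds.
have [|L' [y [wL' L'y CC oy]]] := hf (C x); first by exists L, x.
have hL' := config_line wL'.
exists L'.
  exists y; split=> //; apply: le_trans oy _; rewrite ler_nat.
  exact: leq_bigmax_seq.
apply: (component_linked wL wL' (line_sub_cylinder hL Lx) (line_sub_cylinder hL' L'y)).
rewrite -/(C x) CC; apply: connected_component_refl.
by exists L' => //; exact: line_sub_cylinder.
Qed.

End Components.

Lemma finite_uniform {T : eqType} (F : set T) (P : T -> nat -> Prop) :
  finite_set F -> (forall t m n, (m <= n)%N -> P t m -> P t n) ->
  (forall t, F t -> exists n, P t n) -> exists n, forall t, F t -> P t n.
Proof.
move=> /finite_seqP[s ->] mono h.
have /choice[f hf] : forall t, exists n, t \in s -> P t n.
  move=> t; have [ts|ts] := boolP (t \in s); last by exists 0%N.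
  by have [n Pn] := h t ts; exists n.
exists (\max_(t <- s) f t)%N => t /= ts.
by apply: mono (hf t ts); exact: leq_bigmax_seq.
Qed.

Definition mesh (R : realType) (n : nat) : R := n.+1%:R^-1.

Section Mesh.
Context {R : realType}.

Lemma mesh_gt0 n : 0 < mesh R n.
Proof. by rewrite invr_gt0 ltr0Sn. Qed.

Lemma mesh_lt (e : R) : 0 < e -> exists n, mesh R n < e.
Proof.
move=> e0; exists (Num.truncn e^-1).
by rewrite invf_plt ?posrE ?ltr0Sn// truncnS_gt.
Qed.

Lemma mesh_le (m n : nat) : (m <= n)%N -> mesh R n <= mesh R m.
Proof. by move=> mn; rewrite lef_pV2 ?posrE ?ltr0Sn// ler_nat. Qed.

Lemma mesh_le1 n : mesh R n <= 1.
Proof. by rewrite -invr1; exact: mesh_le (leq0n n). Qed.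

End Mesh.

(** * Linking inside a covered ball *)

Section Configurations.
Context {R : realType} {d : nat}.
Notation H := (hyp R d).
Notation o := (origin R d).
Implicit Types (x y z p q : H) (L : set H) (w : line_config R d).

Lemma hits_le L x (r s : R) : r <= s -> hits L x r -> hits L x s.
Proof. by move=> rs [y [Ly xy]]; exists y; split=> //; exact: le_trans rs. Qed.

Lemma hits_shift L x y (r s : R) : mdist x y + r <= s -> hits L x r -> hits L y s.
Proof.
move=> rs [z [Lz]]; rewrite /hball/= => xz; exists z; split=> //; rewrite /hball/=.
by have := metric_triangle y x z; rewrite (metric_sym y x); lra.
Qed.

Lemma lines_hittingE L x r : geodesic_lines L ->
  lines_hitting (hball x r) L <-> hits L x r.
Proof. by move=> hL; split=> [[]|]. Qed.

Lemma point_at x y (s : R) : 0 <= s <= mdist x y ->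
  exists2 z, mdist x z = s & mdist z y = mdist x y - s.
Proof.
move=> s01; have [xy|/eqP xy] := eqVneq x y.
  exists x; rewrite ?mdistxx ?xy ?mdistxx in s01 *; lra.
have [v pv e] := geodesic_through xy.
exists (geodesic x v s).
  by rewrite -{1}(geodesic0 pv) geodesic_isometric// sub0r normrN ger0_norm; lra.
rewrite -[X in mdist _ X = _]e geodesic_isometric// distrC ger0_norm; lra.
Qed.

(* Walking from the origin in steps of length 1/4, consecutive lines within 3/4 *)
(* of the path have intersecting cylinders.                                     *)
Lemma covered_linked w (r : R) : 0 <= r ->
  (forall x, mdist o x <= r -> exists2 L, val w L & hits L x (3 / 4)) ->
  forall L L', val w L -> val w L' -> hits L o r -> hits L' o r ->
  linked touch (val w) L L'.
Proof.
move=> r0 cov; have [|L0 wL0 L0o] := cov o; first by rewrite mdistxx.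
(* Induction on the number of quarter steps from the origin. A line within 3/4 of the previous point
   [y] is within 1 of [x], hence touches at [x] every line that passes within 1 of [x]. *)
suff h n x L : mdist o x <= n%:R / 4 -> mdist o x <= r -> val w L ->
    hits L x 1 -> linked touch (val w) L0 L.
  have h' L : val w L -> hits L o r -> linked touch (val w) L0 L.
    move=> wL [x [Lx ox]].
    apply: (h (Num.truncn (4 * mdist o x)).+1 x) => //; last first.
      by exists x; split=> //; rewrite /hball/= mdistxx.
    by have := truncnS_gt (4 * mdist o x); lra.
  move=> L L' wL wL' Lo L'o; apply: linked_trans (h' _ wL' L'o).
  by apply: linked_sym (h' _ wL Lo); exact: touchC.
elim: n x L => [|n IH] x L.
  rewrite mul0r => ox _ wL Lx; apply: linked_edge => //; exists o; split.
    by apply: hits_le L0o; lra.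
  suff <- : x = o by [].
  by apply/esym/mdist_positivity/eqP; rewrite eq_le ox mdist_ge0.
rewrite -natr1 => ox xr wL Lx.
have [y oy yx] : exists2 y, mdist o y <= n%:R / 4 /\ mdist o y <= r & mdist y x <= 1 / 4.
  have n0 : 0 <= n%:R :> R by [].
  have [ox4|ox4] := leP (mdist o x) (1 / 4).
    by exists o; rewrite ?mdistxx//; split=> //; lra.
  have [|y oy yx] := @point_at o x (mdist o x - 1 / 4); first lra.
  by exists y; rewrite ?oy ?yx; lra.
have [M wM My] := cov y oy.2.
apply: linked_step (IH y M oy.1 oy.2 wM (hits_le _ My)) wL _; first lra.
by exists x; split=> //; apply: hits_shift My; lra.
Qed.

Lemma rooted_mono w (r s : R) : r <= s -> rooted r w -> rooted s w.
Proof. by move=> rs h L /h[L' L'r LL']; exists L' => //; exact: hits_le L'r. Qed.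

Definition all_linked w :=
  forall L L', val w L -> val w L' -> linked touch (val w) L L'.

Lemma rooted_covered w (r : R) : 0 <= r -> rooted r w ->
  (forall x, mdist o x <= r -> exists2 L, val w L & hits L x (3 / 4)) ->
  all_linked w.
Proof.
move=> r0 hr cov L L' /hr[M Mr LM] /hr[M' M'r LM'].
apply: (linked_trans LM); apply: (linked_trans _ (linked_sym touchC LM')).
exact: covered_linked cov _ _ (linked_r LM) (linked_r LM') Mr M'r.
Qed.

(** * Countable approximation of contact between lines *)

Section Discretization.
Variable q : nat -> H.
Hypothesis qP : forall x (e : R), 0 < e -> exists i, mdist x (q i) < e.

(** A version of [touch] with centers in a dense sequence, at the price of slightly larger radii.
    The bound [n] keeps the centers in a compact ball while [k] goes to infinity. *)
Definition near_touch (k n : nat) L L' := exists i, [/\ mdist o (q i) <= n%:R,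
  hits L (q i) (1 + mesh R k) & hits L' (q i) (1 + mesh R k)].

Lemma near_touch_le k k' n L L' : (k <= k')%N ->
  near_touch k' n L L' -> near_touch k n L L'.
Proof.
move=> kk' [i [qn Li L'i]]; have ki := mesh_le (R := R) kk'.
by exists i; split=> //; [apply: hits_le Li|apply: hits_le L'i]; lra.
Qed.

(** The approximate contact points cluster in the compact ball. If a line missed the unit ball about
    a cluster point it would miss a larger one, by [line_miss_hball]. *)
Lemma near_touch_limit n L L' : geodesic_lines L -> geodesic_lines L' ->
  (forall k, near_touch k n L L') -> touch L L'.
Proof.
move=> hL hL' h; have /choice[f hf] : forall k, exists x,
    [/\ mdist o x <= n%:R, hits L x (1 + mesh R k) & hits L' x (1 + mesh R k)].
  by move=> k; have [i hi] := h k; exists (q i).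
have [z [zn cl]] : hball o n%:R `&` cluster (f @ \oo) !=set0.
  have FF : ProperFilter (f @ \oo) by exact: fmap_proper_filter.
  apply: (@compact_hball R d o n%:R _ FF); exists 0%N => // k _.
  by have [] := hf k.
have key M : geodesic_lines M -> (forall k, hits M (f k) (1 + mesh R k)) ->
    hits M z 1.
  move=> hM Mf; apply: contrapT => /(line_miss_hball hM)[e e0]; apply.
  have e2 : 0 < e / 2 by lra.
  have [N hN] := mesh_lt e2.
  have FN : (f @ \oo) (f @` [set k | (N <= k)%N]).
    by exists N => // k Nk; exists k.
  have [_ [[k /= Nk <-]]] := cl _ _ FN (nbhsx_ballx z _ e2).
  rewrite ballEmdist/= => zf; apply: hits_shift (Mf k).
  by have := mesh_le (R := R) Nk; rewrite metric_sym; lra.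
by exists z; split; apply: key => // k; have [] := hf k.
Qed.

Lemma touch_near L L' : touch L L' ->
  exists n0, forall n, (n0 <= n)%N -> forall k, near_touch k n L L'.
Proof.
move=> [z [Lz L'z]]; exists (Num.truncn (mdist o z + 1)).+1 => n hn k.
have k0 : 0 < mesh R k by exact: mesh_gt0.
have [i hi] := qP z k0.
exists i; split.
- have := truncnS_gt (mdist o z + 1); have := metric_triangle o z (q i).
  have : (Num.truncn (mdist o z + 1)).+1%:R <= n%:R :> R by rewrite ler_nat.
  have := @mesh_le1 R k; lra.
- by apply: hits_shift Lz; lra.
- by apply: hits_shift L'z; lra.
Qed.

Lemma linked_touch_near w L L' : linked touch (val w) L L' ->
  exists n, forall k, linked (near_touch k n) (val w) L L'.
Proof.
suff h : linked touch (val w) L L' ->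
    exists n0, forall n, (n0 <= n)%N -> forall k, linked (near_touch k n) (val w) L L'.
  by move=> /h[n hn]; exists n; exact: hn.
elim=> [wL|M M' _ [n1 h1] wM' /touch_near[n2 h2]].
  by exists 0%N => n _ k; exact: linked_refl.
exists (maxn n1 n2) => n; rewrite geq_max => /andP[n1n n2n] k.
by apply: linked_step (h1 n n1n k) wM' _; exact: h2.
Qed.

(** Only finitely many pairs of lines compete, so the thresholds from [near_touch_limit] have a
    maximum. *)
Lemma near_touch_stable w n : exists k, forall L L', val w L -> val w L' ->
  near_touch k n L L' -> touch L L'.
Proof.
(* The centers are within [n] of the origin and the radii 1 + [mesh R k] are at most 2. *)
pose F := val w `&` lines_hitting (hball o (n%:R + 2)).
have fF : finite_set F by apply: config_finite; exact: compact_hball.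
have [|||k hk] := @finite_uniform _ (F `*` F)
    (fun t k => near_touch k n t.1 t.2 -> touch t.1 t.2).
- exact: finite_setX.
- by move=> t i j ij h /(near_touch_le ij).
- move=> [L L'] [[wL _] [wL' _]] /=; apply: contrapT => h.
  apply: (h); exists 0%N => _; apply: (@near_touch_limit n) => [||k].
  + exact: config_line wL.
  + exact: config_line wL'.
  + by apply: contrapT => nk; apply: h; exists k.
exists k => L L' wL wL' LL'; apply: (hk (L, L')) => //.
have [i [qn Li L'i]] := LL'.
have k1 : mesh R k <= 1 by exact: mesh_le1.
have hit M : val w M -> hits M (q i) (1 + mesh R k) -> F M.
  move=> wM Mi; split=> //; apply/lines_hittingE; first exact: config_line wM.
  by apply: hits_shift Mi; rewrite metric_sym; lra.
by split; apply: hit.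
Qed.

(** A countable family of bounded sets of lines, given by two centers and a radius. Quantifying over
    cells replaces quantifying over the lines of a configuration. *)
Definition cell (t : nat * nat * nat) : set (set H) :=
  lines_hitting (hball (q t.1.1) (mesh R t.2)) `&`
  lines_hitting (hball (q t.1.2) (mesh R t.2)).

(** Two points [x], [y] of [L] determine it, so any other line misses one of them, hence a small
    ball about it. By local finiteness one radius serves for all lines near [x]. *)
Lemma cell_isolates w L : val w L ->
  exists2 t, cell t L & forall L', val w L' -> cell t L' -> L' = L.
Proof.
move=> wL; have hL := config_line wL.
have [x [y [Lx Ly xy]]] : exists x y, [/\ L x, L y & x <> y].
  move: hL => [g hg ->]; exists (g 0), (g 1); split; [by exists 0|by exists 1|].
  by move=> /(congr1 (mdist (g 0))); rewrite mdistxx hg sub0r normrN normr1; lra.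
pose F := val w `&` lines_hitting (hball x 1).
have fF : finite_set F by apply: config_finite; exact: compact_hball.
have [|||k hk] := @finite_uniform _ F (fun M k => M = L \/
    ~ (hits M x (2 * mesh R k) /\ hits M y (2 * mesh R k))).
- exact: fF.
- move=> M i j /(mesh_le (R := R)) ij [->|h]; [by left|right] => -[Mx My]; apply: h.
  by split; [apply: hits_le Mx|apply: hits_le My]; lra.
- move=> M [wM _]; have [->|ML] := pselect (M = L); first by exists 0%N; left.
  have hM := config_line wM.
  have far z : ~ M z -> exists k : nat, ~ hits M z (2 * mesh R k).
    move=> Mz; have [|e e0 he] := @line_miss_hball _ _ M z 0 hM.
      move=> [u [Mu]]; rewrite /hball/= => zu; apply: Mz.
      suff -> : z = u by [].
      by apply/mdist_positivity/eqP; rewrite eq_le zu mdist_ge0.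
    have [|k hk] := @mesh_lt R (e / 2); first lra.
    by exists k => h; apply: he; apply: hits_le h; lra.
  have [Mx|/far[k hk]] := pselect (M x); last by exists k; right => -[].
  have [My|/far[k hk]] := pselect (M y); last by exists k; right => -[].
  by case: ML; exact: (line_unique hM hL xy).
(* The index 1 ensures 2 [mesh R k'] <= 1, so that a line of the cell meets the unit ball about [x]
   and belongs to [F]. *)
pose k' := maxn k 1%N.
have k'0 : 0 < mesh R k' by exact: mesh_gt0.
have [i xi] := qP x k'0; have [j yj] := qP y k'0.
have at_point z u M : M z -> mdist z u < mesh R k' -> hits M u (mesh R k').
  by move=> Mz zu; exists z; split=> //; rewrite /hball/= metric_sym ltW.
exists (i, j, k').
  by split; apply/lines_hittingE => //; [apply: at_point xi|apply: at_point yj].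
move=> M wM [/= /(lines_hittingE _ _ (config_line wM)) Mi].
move=> /(lines_hittingE _ _ (config_line wM)) Mj.
have Mx : hits M x (2 * mesh R k').
  by apply: hits_shift Mi; rewrite metric_sym; lra.
have My : hits M y (2 * mesh R k').
  by apply: hits_shift Mj; rewrite metric_sym; lra.
have kk : mesh R k' <= mesh R k by apply: mesh_le; rewrite leq_maxl.
have k1 : mesh R k' <= 1 / 2 by rewrite mul1r; apply: (@mesh_le R 1); rewrite leq_maxr.
have [|//|[]] := hk M.
  split=> //; apply/lines_hittingE; first exact: config_line wM.
  by apply: hits_le Mx; lra.
by split; [apply: hits_le Mx|apply: hits_le My]; lra.
Qed.

End Discretization.

End Configurations.

(** * Events generated by void events *)

Section VoidEvents.
Context {R : realType} {d : nat}.
Notation H := (hyp R d).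
Notation o := (origin R d).
Implicit Types (x y z p q : H) (L : set H) (w : line_config R d)
  (B C : set (set H)).

Definition mlines B := measurable (B : set (line_space R d)).

(** Bounded sets have finite measure, by [mu_bounded], so their void probabilities are positive. *)
Definition bounded_lines B :=
  mlines B /\ exists2 K : set H, compact K & B `<=` lines_hitting K.

Definition avoid B : set (line_config R d) := [set w | val w `&` B = set0].

Definition void_events := [set avoid B | B in bounded_lines].

(** By [measurable_mvoid] this is coarser than the sigma-algebra of [config_space]. On it, the
    probabilities of void events determine the law. *)
Definition void_space := g_sigma_algebraType void_events.

Definition mvoid (E : set (line_config R d)) := measurable (E : set void_space).

Lemma mlines_hitting (K : set H) : compact K -> mlines (lines_hitting K).
Proof. by move=> cK; apply: sub_sigma_algebra; exists K. Qed.

Lemma bounded_hitting x r : bounded_lines (lines_hitting (hball x r)).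
Proof.
split; first by apply: mlines_hitting; exact: compact_hball.
by exists (hball x r) => //; exact: compact_hball.
Qed.

Lemma bounded_sub B C : mlines B -> bounded_lines C -> B `<=` C -> bounded_lines B.
Proof.
by move=> mB [_ [K cK CK]] BC; split=> //; exists K => //; exact: subset_trans CK.
Qed.

Lemma bounded_setI B C : bounded_lines B -> mlines C -> bounded_lines (B `&` C).
Proof.
move=> hB mC; apply: (bounded_sub _ hB); last exact: subIsetl.
exact: (@measurableI _ (line_space R d)) hB.1 mC.
Qed.

Lemma bounded_setD B C : bounded_lines B -> mlines C -> bounded_lines (B `\` C).
Proof.
move=> hB mC; apply: (bounded_sub _ hB); last exact: subDsetl.
exact: (@measurableD _ (line_space R d)) hB.1 mC.
Qed.

Lemma bounded_setU B C : bounded_lines B -> bounded_lines C ->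
  bounded_lines (B `|` C).
Proof.
move=> [mB [K cK BK]] [mC [K' cK' CK']]; split.
  exact: (@measurableU _ (line_space R d)).
exists (K `|` K'); first exact: compactU.
move=> L [/BK|/CK'] [gL [x [Lx Kx]]]; split=> //; exists x; split=> //.
  by left.
by right.
Qed.

Lemma avoid_setU B C : avoid (B `|` C) = avoid B `&` avoid C.
Proof.
by rewrite /avoid; apply/seteqP; split => w /=; rewrite setIUr setU_eq0.
Qed.

Lemma void_events_setI : setI_closed void_events.
Proof.
move=> _ _ [B hB <-] [C hC <-]; exists (B `|` C); first exact: bounded_setU.
exact: avoid_setU.
Qed.

Lemma mvoid_avoid B : bounded_lines B -> mvoid (avoid B).
Proof. by move=> hB; apply: sub_sigma_algebra; exists B. Qed.

Lemma avoidC B : ~` avoid B = [set w | val w `&` B !=set0].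
Proof. by apply/seteqP; split => w /=; [move/eqP/set0P|move/set0P/eqP]. Qed.

Lemma mvoid_hit B : bounded_lines B -> mvoid [set w | val w `&` B !=set0].
Proof. by move=> hB; rewrite -avoidC; apply: measurableC; exact: mvoid_avoid. Qed.

Lemma mvoid_preimage (f : line_config R d -> line_config R d) :
  (forall B, bounded_lines B -> mvoid (f @^-1` avoid B)) ->
  forall E, mvoid E -> mvoid (f @^-1` E).
Proof.
move=> h E mE.
have mf : measurable_fun [set: void_space] (f : void_space -> void_space).
  apply: (@measurability _ _ void_space void_space setT f void_events) => //.
  move=> _ [_ [B hB <-] <-]; rewrite setTI; exact: h.
by rewrite -[X in mvoid X]setTI; exact: mf.
Qed.

Lemma number_of_lines_eq0 B w : (number_of_lines B w = 0%E) <-> avoid B w.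
Proof.
rewrite /number_of_lines /counting /avoid /=; case: ifPn => /asboolP h.
  split=> [[] /eqP|->]; last by rewrite fset_set0.
  rewrite pnatr_eq0 finmap.cardfs_eq0 => /eqP e.
  by rewrite -(fset_setK h) e set_fset0.
by split=> // e; exfalso; apply: h; rewrite e.
Qed.

Lemma avoid_preimage B : avoid B = number_of_lines B @^-1` [set 0%E].
Proof. by apply/seteqP; split => w /number_of_lines_eq0. Qed.

Lemma measurable_avoid B : mlines B -> measurable (avoid B : set (config_space R d)).
Proof.
move=> mB; apply: sub_sigma_algebra; exists B, [set 0%E].
by split=> //; exact: avoid_preimage.
Qed.

Lemma measurable_mvoid (E : set (line_config R d)) :
  mvoid E -> measurable (E : set (config_space R d)).
Proof.
move: E; apply: smallest_sub => //; first exact: sigma_algebra_measurable.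
by move=> _ [B [mB _] <-]; exact: measurable_avoid.
Qed.

Lemma mvoid_bigcup (I : countType) (F : I -> set (line_config R d)) :
  (forall i, mvoid (F i)) -> mvoid (\bigcup_i F i).
Proof.
by move=> h; apply: (@countable_bigcupT_measurable _ void_space I F) .
Qed.

Lemma mvoid_bigcap (I : countType) (F : I -> set (line_config R d)) :
  (forall i, mvoid (F i)) -> mvoid (\bigcap_i F i).
Proof.
move=> h; rewrite -[X in mvoid X]setCK setC_bigcap.
apply: (@measurableC _ void_space); apply: mvoid_bigcup => i.
by apply: (@measurableC _ void_space); exact: h.
Qed.

(** * Measurability of linking events *)

Section LinkedEvents.
Variable q : nat -> H.
Hypothesis qP : forall x (e : R), 0 < e -> exists i, mdist x (q i) < e.

(** Chains are sorted by length so that measurability can be proved by induction. *)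
Fixpoint reach (r : set H -> set H -> Prop) (W B : set (set H)) (m : nat) :
    set (set H) :=
  if m is m'.+1 then
    [set L' | W L' /\ exists2 L, reach r W B m' L & r L L']
  else W `&` B.

Lemma linked_reach (r : set H -> set H -> Prop) (W B : set (set H)) L' :
  (exists2 L, B L & linked r W L L') <-> exists m, reach r W B m L'.
Proof.
split=> [[L BL]|[m]].
  elim=> [WL|M M' _ [m hm] WM' MM']; first by exists 0%N.
  by exists m.+1; split=> //; exists M.
elim: m L' => [|m IH] L' /=.
  by move=> [WL BL]; exists L' => //; exact: linked_refl.
move=> [WL' [M /IH[L BL LM] ML']]; exists L => //.
exact: linked_step LM WL' ML'.
Qed.

(** The last contact takes place at some center [q i]. Given [i] it decouples: some line near [q i]
    is reached in [m] steps, and some line of [C] passes near [q i]. The target [C] is general so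
    that the induction hypothesis applies to the lines near [q i]. *)
Lemma mvoid_reach k n B : bounded_lines B -> forall m C, bounded_lines C ->
  mvoid [set w | exists2 L, C L & reach (near_touch q k n) (val w) B m L].
Proof.
move=> hB; elim=> [|m IH] C hC.
  rewrite (_ : mkset _ = [set w | val w `&` (B `&` C) !=set0]).
    by apply: mvoid_hit; apply: bounded_setI => //; exact: hC.1.
  apply/seteqP; split => w /= [L].
    by move=> CL [wL BL]; exists L.
  by move=> [wL [BL CL]]; exists L.
pose near_ball i := lines_hitting (hball (q i) (1 + mesh R k)).
pose F i : set (line_config R d) := if mdist o (q i) <= n%:R then
  [set w | exists2 L, near_ball i L & reach (near_touch q k n) (val w) B m L] `&`
  [set w | val w `&` (C `&` near_ball i) !=set0] else set0.
rewrite (_ : mkset _ = \bigcup_i F i).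
  apply: mvoid_bigcup => i; rewrite /F; case: ifP => _.
    apply: (@measurableI _ void_space).
      by apply: IH; exact: bounded_hitting.
    apply: mvoid_hit; apply: bounded_setI => //.
    exact: (bounded_hitting _ _).1.
  exact: (@measurable0 _ void_space).
apply/seteqP; split => w /=.
  move=> [L' CL' [wL' [L hL [i [qn Li L'i]]]]]; exists i => //.
  have wL : val w L by case: (m) hL => [[]|? []].
  rewrite /F qn; split.
    by exists L => //; split=> //; exact: config_line wL.
  by exists L'; split=> //; split=> //; split=> //; exact: config_line wL'.
move=> [i _]; rewrite /F; case: ifP => // qn.
move=> [[L [_ Li] hL] [L' [wL' [CL' [_ L'i]]]]].
by exists L' => //; split=> //; exists L => //; exists i.
Qed.

Definition linked_hit B C : set (line_config R d) :=
  [set w | exists L L', [/\ B L, C L' & linked touch (val w) L L']].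

(** A finite chain of contacts survives, for some [n], as approximate chains for all [k].
    Conversely, for given [n], [near_touch_stable] supplies a [k] at which approximate contact is
    contact. *)
Lemma mvoid_linked_hit B C : bounded_lines B -> bounded_lines C ->
  mvoid (linked_hit B C).
Proof.
move=> hB hC.
rewrite (_ : linked_hit B C = \bigcup_n \bigcap_k \bigcup_m
    [set w | exists2 L, C L & reach (near_touch q k n) (val w) B m L]).
  apply: mvoid_bigcup => n; apply: mvoid_bigcap => k; apply: mvoid_bigcup => m.
  exact: mvoid_reach.
apply/seteqP; split => w.
  move=> [L [L' [BL CL' /(linked_touch_near qP)[n hn]]]]; exists n => // k _.
  have [|m hm] := (linked_reach (near_touch q k n) (val w) B L').1.
    by exists L.
  by exists m => //; exists L'.
move=> [n _ h]; have [k hk] := near_touch_stable q w n.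
have [m _ [L' CL' hL']] := h k I.
have [|L BL LL'] := (linked_reach (near_touch q k n) (val w) B L').2.
  by exists m.
by exists L, L'; split=> //; apply: linked_mono LL'.
Qed.

Lemma bounded_cell t : bounded_lines (cell q t).
Proof.
by apply: bounded_setI; [|apply: (bounded_hitting _ _).1]; exact: bounded_hitting.
Qed.

(** The condition on each line becomes a condition on each cell; conversely the cell that isolates
    [L] recovers the condition on [L]. *)
Lemma mvoid_rooted r : mvoid (rooted r).
Proof.
rewrite (_ : rooted r = \bigcap_t (avoid (cell q t) `|`
    linked_hit (cell q t) (lines_hitting (hball o r)))).
  apply: mvoid_bigcap => t; apply: (@measurableU _ void_space).
    by apply: mvoid_avoid; exact: bounded_cell.
  by apply: mvoid_linked_hit; [exact: bounded_cell|exact: bounded_hitting].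
apply/seteqP; split => w.
  move=> h t _; have [|] := pselect (avoid (cell q t) w); first by left.
  move=> /eqP/set0P[L [wL tL]]; right.
  have [L' L'r LL'] := h L wL; exists L, L'; split=> //; split=> //.
  exact: config_line (linked_r LL').
move=> h L wL; have [t tL isoL] := cell_isolates qP wL.
case: (h t I) => [v|[M [L' [tM [_ L'r] ML']]]].
  by have : (val w `&` cell q t) L by []; rewrite v.
by exists L' => //; rewrite -(isoL M) //; exact: linked_l ML'.
Qed.

Lemma mvoid_all_linked : mvoid all_linked.
Proof.
rewrite (_ : all_linked = \bigcap_s \bigcap_t (avoid (cell q s) `|`
    (avoid (cell q t) `|` linked_hit (cell q s) (cell q t)))).
  apply: mvoid_bigcap => s; apply: mvoid_bigcap => t.
  apply: (@measurableU _ void_space).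
    by apply: mvoid_avoid; exact: bounded_cell.
  apply: (@measurableU _ void_space).
    by apply: mvoid_avoid; exact: bounded_cell.
  by apply: mvoid_linked_hit; exact: bounded_cell.
apply/seteqP; split => w.
  move=> h s _ t _; have [|] := pselect (avoid (cell q s) w); first by left.
  move=> /eqP/set0P[L [wL sL]].
  have [|] := pselect (avoid (cell q t) w); first by right; left.
  move=> /eqP/set0P[L' [wL' tL']]; right; right.
  by exists L, L'; split=> //; exact: h.
move=> h L L' wL wL'.
have [s sL isoL] := cell_isolates qP wL; have [t tL' isoL'] := cell_isolates qP wL'.
case: (h s I t I) => [v|[v|[M [M' [sM tM' MM']]]]].
- by have : (val w `&` cell q s) L by []; rewrite v.
- by have : (val w `&` cell q t) L' by []; rewrite v.
- have eL := isoL M (linked_l MM') sM; have eL' := isoL' M' (linked_r MM') tM'.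
  by rewrite -eL -eL'.
Qed.

End LinkedEvents.

(** A total function, so that thinning and moving can be defined before their results are shown to
    be locally finite. *)
Definition config_of (W : set (set H)) : line_config R d :=
  if pselect (locally_finite_lines W) is left h then exist _ W (mem_set h)
  else exist _ set0 (locally_finite_lines0 R d).

Lemma config_ofE (W : set (set H)) : locally_finite_lines W -> val (config_of W) = W.
Proof. by rewrite /config_of; case: pselect. Qed.

Definition thin B w : line_config R d := config_of (val w `\` B).

Lemma val_thin B w : val (thin B w) = val w `\` B.
Proof.
apply: config_ofE; split; first by move=> L [/config_line].
move=> K cK; apply: sub_finite_set (config_finite w cK).
by move=> L [[]].
Qed.

Lemma thin_avoid B C : thin B @^-1` avoid C = avoid (C `\` B).
Proof.
by apply/seteqP; split => w; rewrite /avoid /= val_thin setIDAC setIDA.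
Qed.

Lemma mvoid_thin B E : mlines B -> mvoid E -> mvoid (thin B @^-1` E).
Proof.
move=> mB; apply: mvoid_preimage => C hC; rewrite thin_avoid.
by apply: mvoid_avoid; exact: bounded_setD.
Qed.

End VoidEvents.

(** * Isometric involutions acting on configurations *)

Section Isometries.
Context {R : realType} {d : nat}.
Notation H := (hyp R d).
Notation o := (origin R d).
Implicit Types (x y z p q : H) (L : set H) (w : line_config R d)
  (B C : set (set H)).

Lemma compact_net (K : set H) (e : R) : compact K -> 0 < e ->
  exists2 s : seq H, (forall y, y \in s -> K y) &
    forall x, K x -> exists2 y, y \in s & mdist y x < e.
Proof.
move=> cK e0.
pose T : ptopologicalType := HB.pack H (isPointed.Build H o).
have cov : @cover_compact T K by rewrite -compact_cover.
have [x _|x Kx|D DK KD] := cov H K (fun x => ball x e).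
- apply/open_hypP => y; rewrite ballEmdist /= => xy.
  exists (e - mdist x y); first lra.
  by move=> z yz /=; have := metric_triangle x y z; lra.
- by exists x => //; exact: ballxx.
exists (finmap.enum_fset D) => [y yD|x /KD[y Dy]]; first by have := DK y yD; rewrite inE.
rewrite ballEmdist /= => xy.
by exists y.
Qed.

Lemma bounded_in_ball B : bounded_lines B ->
  exists n : nat, B `<=` lines_hitting (hball o n%:R).
Proof.
move=> [_ [K cK BK]]; have [s _ hs] := compact_net cK (ltr01 : 0 < (1 : R)).
(* One unit covers the rounding and the other the radius of the net. *)
pose f y := (Num.truncn (mdist o y)).+2.
exists (\max_(y <- s) f y)%N => L /BK[hL [x [Lx Kx]]]; split=> //.
exists x; split=> //; rewrite /hball/=.
have [y ys yx] := hs x Kx.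
have : (f y)%:R <= (\max_(y <- s) f y)%:R :> R.
  by rewrite ler_nat; exact: leq_bigmax_seq.
have := truncnS_gt (mdist o y); have := metric_triangle o y x.
by rewrite /f -[X in X%:R <= _]addn1 natrD; lra.
Qed.

Variable g : H -> H.
Hypotheses (gK : involutive g) (gd : forall x y, mdist (g x) (g y) = mdist x y).

Lemma image_involutive L : g @` (g @` L) = L.
Proof.
rewrite image_comp -[RHS]image_id; apply: eq_imagel => x _ /=; exact: gK.
Qed.

(** Since [g] is an involution this image is also a preimage, by [move_linesE], and measurability
    follows from that. *)
Definition move_lines B : set (set H) := [set g @` L | L in B].

Lemma move_linesE B L : move_lines B L <-> B (g @` L).
Proof.
split=> [[M BM <-]|BL]; first by rewrite image_involutive.
by exists (g @` L) => //; exact: image_involutive.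
Qed.

Lemma move_linesK B : move_lines (move_lines B) = B.
Proof.
by apply/seteqP; split => L; rewrite !move_linesE image_involutive.
Qed.

Lemma hits_image L x r : hits (g @` L) x r <-> hits L (g x) r.
Proof.
split=> [[_ [[y Ly <-]]]|[y [Ly]]]; rewrite /hball/= => h.
  by exists y; split=> //; rewrite /hball/= -gd gK.
by exists (g y); split; [exists y|rewrite /hball/= -gd gK].
Qed.

Lemma geodesic_image L : geodesic_lines (g @` L) <-> geodesic_lines L.
Proof.
by split=> [/(image_line gd)|/(image_line gd)//]; rewrite image_involutive.
Qed.

Lemma move_lines_hball x r :
  move_lines (lines_hitting (hball x r)) = lines_hitting (hball (g x) r).
Proof.
apply/seteqP; split => L.
  by move=> /move_linesE[/geodesic_image gL /hits_image Lx].
by move=> [/geodesic_image gL /hits_image Lx]; apply/move_linesE.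
Qed.

Lemma isometry_continuous : continuous g.
Proof.
move=> x; apply: (metricType_numDomainType.cvgrPdist_lt (F := nbhs x) _ _).2.
move=> e e0; apply/nbhs_ballP; exists e => // y.
by rewrite ballEmdist /= gd.
Qed.

Lemma mlines_move B : mlines B -> mlines (move_lines B).
Proof.
move=> mB.
have -> : move_lines B = (fun L => g @` L) @^-1` B.
  by apply/seteqP; split => L /move_linesE.
have mg : measurable_fun [set: line_space R d]
    ((fun L => g @` L) : line_space R d -> line_space R d).
  apply: (@measurability _ _ (line_space R d) (line_space R d) setT _
    [set lines_hitting K | K in @compact H]) => //.
  move=> _ [_ [K cK <-] <-]; rewrite setTI.
  have -> : (fun L => g @` L) @^-1` lines_hitting K = lines_hitting (g @` K).
    apply/seteqP; split => L /=.
      move=> [/geodesic_image gL [_ [[x Lx <-] Kx]]]; split=> //.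
      by exists x; split=> //; exists (g x) => //; exact: gK.
    move=> [gL [x [Lx [y Ky yx]]]]; split; first exact/geodesic_image.
    by exists y; split=> //; exists x => //; rewrite -yx gK.
  apply: mlines_hitting; apply: continuous_compact => //.
  exact/continuous_subspaceT/isometry_continuous.
by rewrite -[X in mlines X]setTI; exact: mg.
Qed.

Lemma bounded_move B : bounded_lines B -> bounded_lines (move_lines B).
Proof.
move=> hB; have [n hn] := bounded_in_ball hB.
apply: bounded_sub (mlines_move hB.1) (bounded_hitting (g o) n%:R) _.
by rewrite -move_lines_hball => _ [L /hn hL <-]; exists L.
Qed.

Definition move_config w : line_config R d := config_of (move_lines (val w)).

Lemma val_move_config w : val (move_config w) = move_lines (val w).
Proof.
apply: config_ofE; split.
  by move=> _ [L wL <-]; apply/geodesic_image; exact: config_line wL.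
move=> K cK.
have -> : move_lines (val w) `&` lines_hitting K =
    (fun L => g @` L) @` (val w `&` lines_hitting (g @` K)).
  apply/seteqP; split => [_ [[L wL <-] [gL [_ [[x Lx <-] Kx]]]]|].
    exists L => //; split=> //; split; first exact/geodesic_image.
    by exists x; split=> //; exists (g x) => //; exact: gK.
  move=> _ [L [wL [gL [x [Lx [y Ky yx]]]]] <-]; split; first by exists L.
  split; first exact/geodesic_image.
  by exists y; split=> //; exists x => //; rewrite -yx gK.
apply: finite_image; apply: config_finite; apply: continuous_compact => //.
exact/continuous_subspaceT/isometry_continuous.
Qed.

Lemma move_avoid B : move_config @^-1` avoid B = avoid (move_lines B).
Proof.
apply/seteqP; split => w; rewrite /avoid /= val_move_config => h.
  rewrite -subset0 => L [wL /move_linesE BL].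
  have : (move_lines (val w) `&` B) (g @` L) by split=> //; exists L.
  by rewrite h.
rewrite -subset0 => L [/move_linesE wL BL].
have : (val w `&` move_lines B) (g @` L) by split=> //; exists L.
by rewrite h.
Qed.

Lemma mvoid_move E : mvoid E -> mvoid (move_config @^-1` E).
Proof.
apply: mvoid_preimage => B hB; rewrite move_avoid.
by apply: mvoid_avoid; exact: bounded_move.
Qed.

Lemma move_configK w : move_config (move_config w) = w.
Proof.
by apply: val_inj; rewrite /= !val_move_config move_linesK.
Qed.

Lemma touch_image L L' : touch L L' -> touch (g @` L) (g @` L').
Proof.
by move=> [z [Lz L'z]]; exists (g z); split; apply/hits_image; rewrite gK.
Qed.

Lemma all_linked_move : move_config @^-1` all_linked = all_linked.
Proof.
have imp w : all_linked w -> all_linked (move_config w).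
  move=> h L L'; rewrite val_move_config => -[M wM <-] [M' wM' <-].
  exact: linked_image touch_image (h _ _ wM wM').
apply/seteqP; split => w; last exact: imp.
by move=> /imp; rewrite move_configK.
Qed.

End Isometries.

(** * The invariant measure *)

(** Continuity from above at the empty set. It serves for [mu] in [decorrelation] and for [P] in
    [mixing]. *)
Lemma nonincreasing_mu_small {dd} {T : measurableType dd} {R : realType}
    (mu : {measure set T -> \bar R}) (F : (set T)^nat) (e : R) : 0 < e ->
  (mu (F 0%N) < +oo)%E -> (forall n, measurable (F n)) ->
  (forall m n, (m <= n)%N -> F n `<=` F m) -> \bigcap_n F n = set0 ->
  exists n, (mu (F n) < e%:E)%E.
Proof.
move=> e0 F0 mF dF capF; apply: contrapT => /forallNP h.
have c : mu \o F @ \oo --> mu (\bigcap_n F n).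
  apply: nonincreasing_cvg_mu => //; first exact: bigcap_measurableType.
  by move=> m n mn; apply/subsetPset; exact: dF.
rewrite capF measure0 in c.
have : (e%:E <= lim (mu \o F @ \oo))%E.
  apply: lime_ge; first exact: cvgP c.
  by apply: nearW => n; rewrite leNgt; apply/negP; exact: h.
by rewrite (cvg_lim _ c)// lee_fin leNgt e0.
Qed.

Section InvariantMeasure.
Context {R : realType} {d : nat} (mu : {measure set (line_space R d) -> \bar R}).
Hypotheses (hd : (2 <= d)%N) (hmu : invariant_line_measure mu).
Notation H := (hyp R d).
Notation o := (origin R d).
Implicit Types (x y z p q : H) (L : set H) (B C : set (set H)).

Lemma mu_le B C : mlines B -> mlines C -> B `<=` C -> (mu B <= mu C)%E.
Proof. by move=> mB mC BC; apply: (@le_measure _ _ _ mu B C _ _ BC); apply/mem_set. Qed.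

Lemma mu_move (g : H -> H) B : involutive g ->
  (forall x y, mdist (g x) (g y) = mdist x y) -> mlines B ->
  mu (move_lines g B) = mu B.
Proof.
move=> gK gd mB; case: hmu => _ inv _; apply: inv => //.
by split=> //; exists g.
Qed.

Lemma mu_hball x r :
  mu (lines_hitting (hball x r)) = mu (lines_hitting (hball o r)).
Proof.
have gK := @reflectionK R d o x; have gd := @mdist_reflection R d o x.
have := move_lines_hball gK gd o r; rewrite reflection_swap => <-.
by apply: mu_move => //; exact: (bounded_hitting _ _).1.
Qed.

(** The normalization gives unit balls finite mass, wherever they are centered, and finitely many of
    them cover a compact set. *)
Lemma mu_bounded B : bounded_lines B -> (mu B < +oo)%E.
Proof.
move=> [mB [K cK BK]]; have [s _ hs] := compact_net cK (ltr01 : 0 < (1 : R)).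
pose U := fun s : seq H => \big[setU/set0]_(y <- s) lines_hitting (hball y 1).
have mU r : mlines (U r).
  apply: (@bigsetU_measurable _ (line_space R d)) => y _.
  exact: (bounded_hitting _ _).1.
apply: (@le_lt_trans _ _ (mu (U s))).
  apply: mu_le => // L /BK[gL [x [Lx Kx]]]; have [y ys yx] := hs x Kx.
  rewrite /U -bigcup_seq; exists y => //; split=> //; exists x; split=> //.
  exact: ltW.
elim: s {hs} => [|y s IH]; first by rewrite /U big_nil measure0.
rewrite /U big_cons; apply: le_lt_trans (measureU2 mu _ _) _.
- exact: (bounded_hitting _ _).1.
- exact: mU.
- rewrite lte_add_pinfty//; case: hmu => _ _ h.
  by rewrite /= mu_hball h ltry.
Qed.

Lemma mu_fin B : bounded_lines B -> mu B = (fine (mu B))%:E.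
Proof.
move=> hB; rewrite fineK// fin_num_abs gee0_abs//; exact: mu_bounded.
Qed.

(** Otherwise there are arbitrarily far counterexamples, which can be moved to a horocycle. By
    [line_escape] no line hits infinitely many of their balls, while continuity from above would
    give the set of such lines positive measure. *)
Lemma decorrelation (r e : R) : 0 < e -> exists M, forall x, M < mdist o x ->
  (mu (lines_hitting (hball o r) `&` lines_hitting (hball x r)) < e%:E)%E.
Proof.
move=> e0; apply: contrapT => /forallNP h.
have [xi [xi0 xif hor]] := horocycle R hd.
have /choice[y hy] : forall n : nat, exists y, [/\ lorentz y xi = -1,
    n%:R < mdist o y &
    (e%:E <= mu (lines_hitting (hball o r) `&` lines_hitting (hball y r)))%E].
  move=> n; have /existsNP[x /not_implyP[nx /negP]] := h n%:R.
  rewrite -leNgt => ex; have [y yxi oy] := hor _ (mdist_ge0 o x).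
  exists y; split=> //; first by rewrite oy.
  (* [x] and [y] are equally far from the origin, so this reflection fixes the origin and carries
     [x] to the horocycle. *)
  have gK := @reflectionK R d x y; have gd := @mdist_reflection R d x y.
  apply: le_trans ex _; rewrite -(@mu_move (reflection x y)) //; last first.
    apply: (@measurableI _ (line_space R d)); exact: (bounded_hitting _ _).1.
  rewrite le_eqVlt; apply/orP; left; apply/eqP; congr (mu _).
  have := move_lines_hball gK gd x r; rewrite reflection_swap => <-.
  have := move_lines_hball gK gd o r; rewrite (reflection_fix (esym oy)) => ho.
  rewrite -[in RHS]ho.
  apply/seteqP; split => L.
    by move=> /(move_linesE gK)[? ?]; split; apply/(move_linesE gK).
  by move=> [/(move_linesE gK) ? /(move_linesE gK) ?]; apply/(move_linesE gK).
pose A n := lines_hitting (hball o r) `&` lines_hitting (hball (y n) r).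
have mA n : mlines (A n).
  by apply: (@measurableI _ (line_space R d)); exact: (bounded_hitting _ _).1.
(* Tail unions: their intersection is the set of lines that belong to infinitely many [A n]. *)
pose F m : set (line_space R d) := \bigcup_(n in [set k | (m <= k)%N]) A n.
have mF m : measurable (F m) by apply: bigcup_measurable => n _; exact: mA.
have [|||n] := @nonincreasing_mu_small _ _ _ mu F e e0 _ mF.
- apply: le_lt_trans (mu_bounded (bounded_hitting o r)).
  apply: (mu_le (mF 0%N) (bounded_hitting o r).1).
  by move=> L [n _ []].
- by move=> m n mn L [k /= nk Ak]; exists k => //=; exact: leq_trans nk.
- rewrite -subset0 => L hL.
  have gL : geodesic_lines L by have [k _ [[]]] := hL 0%N I.
  have [M hM] := line_escape xi0 xif r gL.
  have [k /= Mk [_ [_ Lk]]] := hL (Num.truncn M).+1 I.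
  have [yk ok _] := hy k; apply: (hM (y k)) => //.
  apply: lt_trans ok; apply: lt_le_trans (truncnS_gt M) _.
  by rewrite ler_nat.
- have [_ _ +] := hy n; rewrite ltNge => /le_trans h1 /negP; apply; apply: h1.
  apply: (mu_le (mA n) (mF n)).
  by move=> L AL; exists n => /=.
Qed.

(** Countably many translates of the ball are hit by all lines. Positivity for small balls is thus
    obtained by contradiction, without computing the measure. *)
Lemma null_ball_null (rho : R) : 0 < rho ->
  mu (lines_hitting (hball o rho)) = 0%E ->
  forall B, bounded_lines B -> mu B = 0%E.
Proof.
move=> rho0 h0 B hB; have [q qP] := @hyp_separable R d.
have [n hn] := bounded_in_ball hB.
apply/eqP; rewrite eq_le measure_ge0 andbT.
have := @measure_sigma_subadditive _ _ _ mu B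
  (fun i => lines_hitting (hball (q i) rho)).
move=> /(_ _ _ _)/wrap[]; rewrite ?eseries0//.
- by move=> i; exact: (bounded_hitting _ _).1.
- exact: hB.1.
- move=> L /hn[gL [x [Lx _]]]; have [|i hi] := qP x rho; first by [].
  by exists i => //; split=> //; exists x; split=> //; rewrite /hball/= metric_sym ltW.
- by move=> i _ _; rewrite mu_hball.
Qed.

(** Lines through B(o, rho) are unbounded, so each also hits a ball of radius [rho] about a far
    point of the dense sequence. One of these countably many sets is not null, it has measure below
    [e] by [decorrelation], and a reflection brings it to [z]. *)
Lemma small_positive_set z (rho e : R) : 0 < rho -> 0 < e ->
  mu (lines_hitting (hball o rho)) <> 0%E ->
  exists B, [/\ bounded_lines B, B `<=` lines_hitting (hball z rho),
    mu B <> 0%E & (mu B < e%:E)%E].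
Proof.
move=> rho0 e0 h0; have [q qP] := @hyp_separable R d.
have [M hM] := decorrelation rho e0.
pose B x := lines_hitting (hball o rho) `&` lines_hitting (hball x rho).
have mB x : mlines (B x).
  by apply: (@measurableI _ (line_space R d)); exact: (bounded_hitting _ _).1.
have [x Mx hx] : exists2 x, M < mdist o x & mu (B x) <> 0%E.
  apply: contrapT => h; apply: h0; apply/eqP; rewrite eq_le measure_ge0 andbT.
  have := @measure_sigma_subadditive _ _ _ mu (lines_hitting (hball o rho))
    (fun i => if M < mdist o (q i) then B (q i) else set0).
  move=> /(_ _ _ _)/wrap[]; rewrite ?eseries0//.
  - by move=> i; case: ifP => // _; exact: mB.
  - exact: (bounded_hitting _ _).1.
  - move=> L Lo; have [gL _] := Lo.
    (* The extra [rho] keeps a center [q i] within [rho] of [y] farther than [M] from the origin. *)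
    have [y Ly My] : exists2 y, L y & M + rho < mdist o y.
      apply: contrapT => hy; apply: (@line_unbounded _ _ L o (M + rho) gL) => y Ly.
      by rewrite /hball/= leNgt; apply/negP => ?; apply: hy; exists y.
    have [|i hi] := qP y rho; first by [].
    exists i => //; have := metric_triangle o (q i) y.
    rewrite (metric_sym (q i) y) => tri.
    rewrite ifT; last lra.
    split=> //; split=> //; exists y; split=> //.
    by rewrite /hball/= metric_sym ltW.
  - move=> i _ _; case: ifP => [Mi|_]; last exact: measure0.
    by apply: contrapT => hi; apply: h; exists (q i).
have gK := @reflectionK R d o z; have gd := @mdist_reflection R d o z.
have bB : bounded_lines (B x).
  by apply: bounded_setI; [|apply: (bounded_hitting _ _).1]; exact: bounded_hitting.
exists (move_lines (reflection o z) (B x)); split.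
- exact: bounded_move.
- have := move_lines_hball gK gd o rho; rewrite reflection_swap => <-.
  by move=> L /(move_linesE gK)[h _]; apply/(move_linesE gK).
- by rewrite mu_move.
- by rewrite mu_move//; exact: hM.
Qed.

End InvariantMeasure.

(** * The Poisson process *)

Section Poisson.
Context {R : realType} {d : nat} (mu : {measure set (line_space R d) -> \bar R}).
Hypotheses (hd : (2 <= d)%N) (hmu : invariant_line_measure mu).
Variables (u : R) (P : probability (config_space R d) R).
Hypotheses (hu0 : 0 < u) (hP : poisson_process (fun B => (u%:E * mu B)%E) P).
Notation H := (hyp R d).
Notation o := (origin R d).
Implicit Types (x y z : H) (B C : set (set H)) (E F : set (line_config R d)).

Let p (E : set (line_config R d)) : R := fine (P E).

Let PE E : mvoid E -> P E = (p E)%:E.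
Proof.
move=> mE; rewrite fineK//; apply: fin_num_measure; exact: measurable_mvoid.
Qed.

Lemma mvoidI E F : mvoid E -> mvoid F -> mvoid (E `&` F).
Proof. exact: (@measurableI _ (void_space (R := R) (d := d))). Qed.

Lemma mvoidU E F : mvoid E -> mvoid F -> mvoid (E `|` F).
Proof. exact: (@measurableU _ (void_space (R := R) (d := d))). Qed.

Lemma mvoidC E : mvoid E -> mvoid (~` E).
Proof. exact: (@measurableC _ (void_space (R := R) (d := d))). Qed.

Let p_ge0 E : 0 <= p E.
Proof. by rewrite fine_ge0. Qed.

Let p_le E F : mvoid E -> mvoid F -> E `<=` F -> p E <= p F.
Proof.
move=> mE mF EF; rewrite -lee_fin -!PE//.
apply: (@le_measure _ _ _ P E F _ _ EF); apply/mem_set; exact: measurable_mvoid.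
Qed.

Let pT : p setT = 1.
Proof. by rewrite /p probability_setT. Qed.

Let pU E F : mvoid E -> mvoid F -> E `&` F = set0 -> p (E `|` F) = p E + p F.
Proof.
move=> mE mF EF; apply: EFin_inj; rewrite EFinD -!PE//; last exact: mvoidU.
by apply: measureU => //; exact: measurable_mvoid.
Qed.

Let p_split E F : mvoid E -> mvoid F -> p E = p (E `&` F) + p (E `&` ~` F).
Proof.
move=> mE mF; rewrite -pU; first by rewrite -setIUr setUv setIT.
- exact: mvoidI.
- by apply: mvoidI => //; exact: mvoidC.
- by rewrite setIACA setICr setI0.
Qed.

Let pC E : mvoid E -> p (~` E) = 1 - p E.
Proof.
move=> mE; rewrite -pT (p_split (E := setT) _ mE) ?setTI; first lra.
exact: (@measurableT _ (void_space (R := R) (d := d))).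
Qed.

(** Dynkin's theorem: void events form a pi-system, because avoiding two sets is avoiding their
    union. *)
Lemma avoid_induction (Q : set (line_config R d) -> Prop) : Q setT ->
  (forall B, bounded_lines B -> Q (avoid B)) ->
  (forall E, mvoid E -> Q E -> Q (~` E)) ->
  (forall F : (set (line_config R d))^nat, (forall n, mvoid (F n)) ->
    trivIset setT F -> (forall n, Q (F n)) -> Q (\bigcup_n F n)) ->
  forall E, mvoid E -> Q E.
Proof.
move=> QT Qa QC QU E mE.
apply: (@dynkin_induction _ (void_space (R := R) (d := d)) (void_events (R := R) (d := d)) Q) => //.
- exact: void_events_setI.
- by move=> _ [B hB <-]; exact: Qa.
Qed.

Lemma avoid_probability B : bounded_lines B ->
  p (avoid B) = expR (- (u * fine (mu B))).
Proof.
move=> hB; case: hP => h _ _; have muB := mu_fin hmu hB.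
have := h B hB.1 _ 0%N; rewrite -avoid_preimage muB -EFinM ltry => /(_ isT).
by rewrite /p => ->; rewrite /= fact0 divr1 expr0 mul1r.
Qed.

Section Independence.
Variables (f : line_config R d -> line_config R d) (A : set (line_config R d)).
Hypotheses (mf : forall E, mvoid E -> mvoid (f @^-1` E)) (mA : mvoid A).

(** Applied with [f] the identity for the zero-one law, and with [f] a thinning for the insertion of
    lines. *)
Lemma independence_induction :
  (forall B, bounded_lines B ->
    p (f @^-1` avoid B `&` A) = p (f @^-1` avoid B) * p A) ->
  forall E, mvoid E -> p (f @^-1` E `&` A) = p (f @^-1` E) * p A.
Proof.
move=> hB; apply: avoid_induction => //.
- by rewrite preimage_setT setTI pT mul1r.
- move=> E mE h; rewrite preimage_setC.
  have := p_split mA (mf mE); rewrite pC; last exact: mf.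
  by rewrite setIC h (setIC A); lra.
- move=> F mF tF h; apply: EFin_inj; rewrite EFinM -!PE//; last 2 first.
  + by apply: mf; apply: mvoid_bigcup.
  + by apply: mvoidI => //; apply: mf; apply: mvoid_bigcup.
  rewrite preimage_bigcup setI_bigcupl !measure_bigcup//.
  + rewrite muleC PE// -nneseriesZl//; apply: eq_eseriesr => n _.
    apply: (etrans (PE (mvoidI (mf (mF n)) mA))).
    by rewrite h mulrC EFinM; congr (_ * _)%E; exact: esym (PE (mf (mF n))).
  + by move=> n _; apply: measurable_mvoid; exact: mf.
  + by move=> i j _ _ [w [wi wj]]; apply: tF => //; exists (f w).
  + by move=> n _; apply: measurable_mvoid; apply: mvoidI => //; exact: mf.
  + by move=> i j _ _ [w [[wi _] [wj _]]]; apply: tF => //; exists (f w).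
Qed.

End Independence.

Section MoveInvariance.
Variable g : H -> H.
Hypotheses (gK : involutive g) (gd : forall x y, mdist (g x) (g y) = mdist x y).

(** Void probabilities depend on the measure of the avoided set only, so the law inherits the
    invariance of [mu]. *)
Lemma move_probability E : mvoid E -> p (move_config g @^-1` E) = p E.
Proof.
have mg := mvoid_move gK gd.
move: E; apply: avoid_induction.
- by rewrite preimage_setT.
- move=> B hB; rewrite move_avoid// !avoid_probability//; last exact: bounded_move.
  by rewrite (mu_move hmu gK gd hB.1).
- by move=> E mE h; rewrite preimage_setC !pC// ?h//; exact: mg.
- move=> F mF tF h; apply: EFin_inj; rewrite -!PE; last 2 first.
  + exact: mvoid_bigcup.
  + by apply: mg; exact: mvoid_bigcup.
  rewrite preimage_bigcup !measure_bigcup//.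
  + apply: eq_eseriesr => n _; apply: (etrans (PE (mg _ (mF n)))).
    by rewrite h; exact: esym (PE (mF n)).
  + by move=> n _; apply: measurable_mvoid; exact: mF.
  + by move=> n _; apply: measurable_mvoid; exact: mg.
  + by move=> i j _ _ [w [wi wj]]; apply: tF => //; exists (move_config g w).
Qed.

End MoveInvariance.

(** * Mixing and the zero-one law *)

Let rmove x := move_lines (reflection o x).

Let bounded_rmove x C : bounded_lines C -> bounded_lines (rmove x C).
Proof.
by apply: bounded_move; [exact: reflectionK|exact: mdist_reflection].
Qed.

Let p_rmove x C : bounded_lines C -> p (avoid (rmove x C)) = p (avoid C).
Proof.
move=> hC; rewrite !avoid_probability//; last exact: bounded_rmove.
rewrite (mu_move hmu) //; [exact: reflectionK|exact: mdist_reflection|exact: hC.1].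
Qed.

Let mixes F := forall C, bounded_lines C -> forall e, 0 < e ->
  exists M, forall x, M < mdist o x ->
    `|p (F `&` avoid (rmove x C)) - p F * p (avoid C)| <= e.

(** With C' the moved set, avoiding both [B] and C' has probability P(avoid B) P(avoid C) exp(u mu(B
    [&] C')). The last factor tends to 1 by [decorrelation]. *)
Let mixes_avoid B : bounded_lines B -> mixes (avoid B).
Proof.
move=> hB C hC e e0.
have [i hi] := bounded_in_ball hB; have [j hj] := bounded_in_ball hC.
pose r : R := (maxn i j)%:R.
have sub (k : nat) x : (k <= maxn i j)%N ->
    lines_hitting (hball x k%:R) `<=` lines_hitting (hball x r).
  move=> kij L [gL xL]; split=> //.
  by move: xL; apply: hits_le; rewrite ler_nat.
(* An overlap of measure below [dl] has exp(u mu) at most 1 + [e]. *)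
pose dl := ln (1 + e) / u.
have l0 : 0 < ln (1 + e) by apply: ln_gt0; lra.
have dl0 : 0 < dl by rewrite divr_gt0.
have [M hM] := decorrelation hd hmu r dl0.
exists M => x Mx; rewrite -avoid_setU.
have hC' := bounded_rmove x hC.
have hI : bounded_lines (B `&` rmove x C) by apply: bounded_setI => //; exact: hC'.1.
have small : fine (mu (B `&` rmove x C)) < dl.
  rewrite -lte_fin -(mu_fin hmu hI); apply: le_lt_trans (hM x Mx).
  apply: mu_le; first exact: hI.1.
    by apply: (@measurableI _ (line_space R d)); exact: (bounded_hitting _ _).1.
  move=> L [/hi BL]; have gK := @reflectionK R d o x.
  move=> /(move_linesE gK)/hj CL; split.
    by apply: sub BL; exact: leq_maxl.
  apply: (sub j); first exact: leq_maxr.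
  have := move_lines_hball gK (@mdist_reflection R d o x) o j%:R.
  by rewrite reflection_swap => <-; apply/(move_linesE gK).
have sum : fine (mu (B `|` rmove x C)) =
    fine (mu B) + fine (mu C) - fine (mu (B `&` rmove x C)).
  have hDI : mu B = (mu (B `\` rmove x C) + mu (B `&` rmove x C))%E.
    exact: measureDI hB.1 hC'.1.
  have -> : B `|` rmove x C = (B `\` rmove x C) `|` rmove x C.
    apply/seteqP; split => L; last by move=> [[? _]|?]; [left|right].
    move=> [BL|CL]; last by right.
    by have [?|?] := pselect (rmove x C L); [right|left].
  have hD := bounded_setD hB hC'.1.
  have hU : mu ((B `\` rmove x C) `|` rmove x C) =
      (mu (B `\` rmove x C) + mu (rmove x C))%E.
    by apply: measureU; [exact: hD.1|exact: hC'.1|rewrite setIC setDIK].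
  have eC : mu (rmove x C) = mu C.
    by apply: (mu_move hmu) => //; [exact: reflectionK|exact: mdist_reflection|exact: hC.1].
  move: hDI; rewrite hU eC (mu_fin hmu hD) (mu_fin hmu hI) (mu_fin hmu hB).
  by rewrite (mu_fin hmu hC) -!EFinD /= => -[]; lra.
rewrite !avoid_probability//; last exact: bounded_setU.
rewrite sum; set a := fine _; set b := fine (mu C); set c := fine _ in small *.
have c0 : 0 <= c by rewrite fine_ge0.
have a0 : 0 <= a by rewrite fine_ge0.
have b0 : 0 <= b by rewrite fine_ge0.
have -> : - (u * (a + b - c)) = (- (u * a) + - (u * b)) + u * c by ring.
rewrite expRD expRD.
have E1 : expR (u * c) <= 1 + e.
  rewrite -[leRHS]lnK ?posrE; last lra.
  rewrite ler_expR -ler_pdivlMl// mulrC; exact: ltW.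
have E2 : 1 <= expR (u * c) by rewrite -expR0 ler_expR mulr_ge0// ltW.
have E3 : expR (- (u * a)) <= 1 by rewrite -expR0 ler_expR oppr_le0 mulr_ge0// ltW.
have E4 : expR (- (u * b)) <= 1 by rewrite -expR0 ler_expR oppr_le0 mulr_ge0// ltW.
have := expR_ge0 (- (u * a)); have := expR_ge0 (- (u * b)).
set A := expR (- (u * a)) in E3 *; set A' := expR (- (u * b)) in E4 *.
set A'' := expR _ in E1 E2 *; move=> A0 A0'.
rewrite (_ : A * A' * A'' - A * A' = A * A' * (A'' - 1)); last by ring.
have AA : 0 <= A * A' <= 1 by apply/andP; split; nra.
by rewrite ger0_norm; nra.
Qed.

Let mixesU E F : mvoid E -> mvoid F -> E `&` F = set0 ->
  mixes E -> mixes F -> mixes (E `|` F).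
Proof.
move=> mE mF EF hE hF C hC e e0; have e2 : 0 < e / 2 by lra.
have [M hM] := hE C hC _ e2; have [M' hM'] := hF C hC _ e2.
exists (Num.max M M') => x; rewrite gt_max => /andP[Mx M'x].
have mV : mvoid (avoid (rmove x C)) by apply: mvoid_avoid; exact: bounded_rmove.
rewrite setIUl !pU//; [|exact: mvoidI|exact: mvoidI|].
  by have := hM x Mx; have := hM' x M'x; rewrite !ler_norml; nra.
by rewrite setIACA EF set0I.
Qed.

(** Dynkin induction from [mixes_avoid]. A disjoint countable union is approximated by its finite
    parts, to which [mixesU] applies. *)
Lemma mixing F : mvoid F -> mixes F.
Proof.
move: F; apply: avoid_induction => //.
- move=> C hC e e0; exists 0 => x _.
  by rewrite setTI pT mul1r p_rmove// subrr normr0 ltW.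
- move=> F mF hF C hC e e0; have [M hM] := hF C hC e e0.
  exists M => x /hM; rewrite pC//.
  have mV : mvoid (avoid (rmove x C)) by apply: mvoid_avoid; exact: bounded_rmove.
  have := p_split mV mF; rewrite p_rmove// => h.
  have -> : p (~` F `&` avoid (rmove x C)) = p (avoid C) - p (F `&` avoid (rmove x C)).
    by rewrite setIC (setIC F); lra.
  by rewrite -normrN; congr (`|_| <= _); ring.
move=> F mF tF hF C hC e e0.
pose T n : set (line_config R d) := \bigcup_(k in [set k | (n <= k)%N]) F k.
have mT n : mvoid (T n).
  by apply: (@bigcup_measurable _ (void_space (R := R) (d := d))) => k _; exact: mF.
pose G n : set (line_config R d) := \big[setU/set0]_(k < n) F k.
have mG n : mvoid (G n).
  by apply: (@bigsetU_measurable _ (void_space (R := R) (d := d))) => k _; exact: mF.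
have mixG n : mixes (G n).
  elim: n => [|n IH].
    move=> C' hC' e' e'0; exists 0 => x _; rewrite /G big_ord0 set0I.
    by rewrite /p measure0 mul0r subrr normr0 ltW.
  rewrite /G big_ord_recr; apply: mixesU; [exact: mG|exact: mF| |exact: IH|exact: hF].
  rewrite -subset0 => w []; rewrite -bigcup_mkord => -[k /= kn Fk] Fn.
  by have /eqP := tF k n I I ltac:(by exists w); rewrite ltn_eqF.
(* The finite part [G n] contributes an error of at most e/2, and each of the two terms that involve
   the tail [T n] is at most e/4. *)
have e3 : 0 < e / 4 by lra.
have [||||n Tn] := @nonincreasing_mu_small _ _ _ P T (e / 4) e3.
- by apply: le_lt_trans (probability_le1 P (measurable_mvoid (mT 0%N))) _; rewrite ltry.
- by move=> n; apply: measurable_mvoid.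
- by move=> m n mn w [k /= nk Fk]; exists k => //=; exact: leq_trans nk.
- rewrite -subset0 => w h; have [k _ Fk] := h 0%N I.
  have [k' /= kk' Fk'] := h k.+1 I.
  have : k = k' by apply: tF => //; exists w.
  by move=> e'; move: kk'; rewrite -e' ltnn.
have -> : \bigcup_k F k = G n `|` T n.
  rewrite /G -bigcup_mkord; apply/seteqP; split => w.
    move=> [k _ Fk]; case: (ltnP k n) => kn; first by left; exists k.
    by right; exists k.
  by move=> [|] [k _ Fk]; exists k.
have {}Tn : p (T n) <= e / 4.
  by rewrite -lee_fin -PE// ltW.
have [|M hM] := mixG n C hC (e / 2); first lra.
exists M => x /hM h.
have mV : mvoid (avoid (rmove x C)) by apply: mvoid_avoid; exact: bounded_rmove.
have GT : G n `&` T n = set0.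
  rewrite -subset0 => w []; rewrite /G -bigcup_mkord => -[k /= kn Fk] [k' /= nk' Fk'].
  have : k = k' by apply: tF => //; exists w.
  by move=> e'; move: kn; rewrite e' ltnNge nk'.
rewrite setIUl !pU//; [|exact: mvoidI|exact: mvoidI|by rewrite setIACA GT set0I].
have T1 : p (T n `&` avoid (rmove x C)) <= e / 4.
  by apply: le_trans Tn; apply: p_le => //; exact: mvoidI.
have T0 := p_ge0 (T n `&` avoid (rmove x C)); have T0' := p_ge0 (T n).
have c1 : p (avoid C) <= 1.
  rewrite -pT; apply: p_le => //; first exact: mvoid_avoid.
  exact: (@measurableT _ (void_space (R := R) (d := d))).
have c0 := p_ge0 (avoid C).
by move: h; rewrite !ler_norml; nra.
Qed.

Lemma far_point (M : R) : exists x, M < mdist o x.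
Proof.
have [xi [_ _ h]] := horocycle R hd.
have [|x _ ox] := h (Num.max 0 M + 1).
  by rewrite addr_ge0// le_max lexx.
exists x; rewrite ox; apply: (@le_lt_trans _ _ (Num.max 0 M)); last lra.
by rewrite le_max lexx orbT.
Qed.

(** Invariance of [E] and of the law lets a void event be moved far away without changing its joint
    probability with [E]. Mixing then makes [E] independent of void events, hence of itself. *)
Lemma zero_one E : mvoid E ->
  (forall x, move_config (reflection o x) @^-1` E = E) -> p E = 0 \/ p E = 1.
Proof.
move=> mE inv.
have ind C : bounded_lines C -> p (avoid C `&` E) = p (avoid C) * p E.
  move=> hC; rewrite setIC mulrC; apply/eqP; rewrite -subr_eq0 -normr_le0.
  apply/ler_addgt0Pl => e e0; rewrite addr0.
  have [M hM] := mixing mE hC e0; have [x Mx] := far_point M.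
  have gK := @reflectionK R d o x; have gd := @mdist_reflection R d o x.
  have := move_probability gK gd (mvoidI mE (mvoid_avoid hC)).
  by rewrite preimage_setI inv move_avoid// => <-; exact: hM.
have := @independence_induction id E (fun _ h => h) mE ind E mE.
rewrite /= setIid => h.
have [->|n0] := eqVneq (p E) 0; [by left|right].
by apply: (mulfI n0); rewrite mulr1 -h.
Qed.

(** The configuration outside [B] is independent of [avoid B], so the probability factors. The
    factor of the thinned event is positive because thinning fixes the configurations that avoid
    [B], and [D] cannot be contained in the less probable event of hitting [B]. *)
Lemma insertion D B : mvoid D -> bounded_lines B -> mu B <> 0%E ->
  1 - p (avoid B) < p D -> 0 < p (thin B @^-1` D `&` ~` avoid B).
Proof.
move=> mD hB B0 hD.
have mA := mvoid_avoid hB.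
have mthin F : mvoid F -> mvoid (thin B @^-1` F) by apply: mvoid_thin; exact: hB.1.
have B1 : 0 < fine (mu B).
  rewrite lt_neqAle fine_ge0// andbT; apply/eqP => e; apply: B0.
  by rewrite (mu_fin hmu hB) -e.
have A1 : p (avoid B) < 1.
  by rewrite avoid_probability// -expR0 ltr_expR oppr_lt0 mulr_gt0.
have ind C : bounded_lines C ->
    p (thin B @^-1` avoid C `&` avoid B) = p (thin B @^-1` avoid C) * p (avoid B).
  move=> hC; have hCB := bounded_setD hC hB.1.
  rewrite thin_avoid -avoid_setU !avoid_probability//; last exact: bounded_setU.
  rewrite -expRD -opprD -mulrDr; congr (expR (- (u * _))).
  apply: EFin_inj; rewrite EFinD -!(mu_fin hmu)//; last exact: bounded_setU.
  by apply: measureU; [exact: hCB.1|exact: hB.1|rewrite setIC setDIK].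
have hind := independence_induction mthin mA ind mD.
have mT := mthin _ mD.
have sp := p_split mT mA.
have : p (D `&` avoid B) <= p (thin B @^-1` D).
  apply: p_le => //; first exact: mvoidI.
  move=> w [Dw Bw]; rewrite /preimage /=; suff -> : thin B w = w by [].
  apply: val_inj; rewrite /= val_thin; apply/seteqP; split => L; first by case.
  move=> wL; split=> // BL; have : (val w `&` B) L by [].
  by rewrite Bw.
have spD := p_split mD mA.
have : p (D `&` ~` avoid B) <= p (~` avoid B).
  by apply: p_le => //; [apply: mvoidI => //; exact: mvoidC|exact: mvoidC].
rewrite pC// => h1 h2.
have T0 : 0 < p (thin B @^-1` D) by lra.
have : 0 < p (thin B @^-1` D) * (1 - p (avoid B)) by rewrite mulr_gt0//; lra.
by rewrite hind in sp; lra.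
Qed.

(** Apply [insertion] to a small set [B] of lines near [z]. Restoring the lines in [B] keeps the
    configuration in [D], since they all hit B(o, r) and [D] is stable under adding such lines. *)
Lemma insert_line (D : set (line_config R d)) (rho r : R) z : 0 < rho ->
  mu (lines_hitting (hball o rho)) <> 0%E ->
  mvoid D -> mdist o z + rho <= r ->
  (forall w w' : line_config R d, D w -> val w `<=` val w' ->
     (forall L, val w' L -> ~ val w L -> hits L o r) -> D w') ->
  0 < p D -> 0 < p (D `&` [set w | val w `&` lines_hitting (hball z rho) !=set0]).
Proof.
move=> rho0 mu0 mD zr mono D0.
have l0 : 0 < p D / 2 by lra.
have [B [hB Bz B0 Be]] := small_positive_set hd hmu z rho0 (divr_gt0 l0 hu0) mu0.
have mhit : mvoid [set w : line_config R d | val w `&` lines_hitting (hball z rho) !=set0].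
  exact: mvoid_hit (bounded_hitting _ _).
apply: lt_le_trans (insertion mD hB B0 _) _.
  rewrite avoid_probability//.
  (* The probability of hitting [B], 1 - exp(- u mu B), is at most u mu B, which is below half of
     [p D]. *)
  have : fine (mu B) < p D / 2 / u by rewrite -lte_fin -(mu_fin hmu hB).
  rewrite ltr_pdivlMr// => h; have := expR_ge1Dx (- (u * fine (mu B))).
  by lra.
apply: p_le.
- by apply: mvoidI; [apply: mvoid_thin mD; exact: hB.1|apply: mvoidC; exact: mvoid_avoid].
- exact: mvoidI.
move=> w [Dw]; rewrite avoidC => -[L [wL BL]]; split; last first.
  by exists L; split=> //; exact: Bz.
apply: mono Dw _ _ => [M|M wM]; rewrite val_thin; first by case.
move=> /not_andP[//|/contrapT/Bz[_]]; apply: hits_shift.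
by rewrite metric_sym.
Qed.

Lemma rooted_add (r : R) (w w' : line_config R d) : rooted r w -> val w `<=` val w' ->
  (forall L, val w' L -> ~ val w L -> hits L o r) -> rooted r w'.
Proof.
move=> hr ww' hw' L w'L; have [wL|wL] := pselect (val w L).
  have [L' L'r LL'] := hr L wL; exists L' => //.
  exact: linked_mono LL'.
exists L; first exact: hw'.
exact: linked_refl.
Qed.

(** If the event had positive probability, so would the event with a line inserted near each point
    of a net. There the lines come within 3/8 of every point of B(o, r), so [rooted_covered] links
    everything. *)
Lemma rooted_null (n : nat) : mu (lines_hitting (hball o (1 / 8))) <> 0%E ->
  p all_linked = 0 -> p (rooted n%:R) = 0.
Proof.
move=> mu0 E0; have [q qP] := @hyp_separable R d.
have mr := mvoid_rooted qP; have mE := mvoid_all_linked qP.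
apply/eqP; rewrite eq_le p_ge0 andbT leNgt; apply/negP => p0.
pose r : R := n%:R + 1; have n0 : 0 <= n%:R :> R by [].
(* The margin 1/8 ensures that a line within 1/8 of a net point hits B(o, r), and so is admissible
   in [rooted_add]. *)
have [|s sK hs] := @compact_net R d (hball o (r - 1 / 8)) (1 / 8) _ ltac:(lra).
  exact: compact_hball.
have [D [mD DE D0]] : exists D, [/\ mvoid D, D `<=` rooted r `&`
    [set w | forall z, z \in s -> val w `&` lines_hitting (hball z (1 / 8)) !=set0]
    & 0 < p D].
  (* For the induction on the net, [D] must also be stable under adding lines that hit B(o, r);
     [insert_line] relies on this at each step. *)
  suff : exists D, [/\ mvoid D, D `<=` rooted r `&`
      [set w | forall z, z \in s -> val w `&` lines_hitting (hball z (1 / 8)) !=set0],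
      (forall w w' : line_config R d, D w -> val w `<=` val w' ->
     (forall L, val w' L -> ~ val w L -> hits L o r) -> D w') & 0 < p D].
    by move=> [D [? ? _ ?]]; exists D.
  elim: s sK {hs} => [|z s IH] sK.
    exists (rooted r); split.
    - exact: mr.
    - by move=> w rw; split.
    - exact: rooted_add.
    - apply: lt_le_trans p0 _; apply: p_le; [exact: mr|exact: mr|].
      by move=> w; apply: rooted_mono; rewrite /r; lra.
  have [|D [mD DE mono D0]] := IH; first by move=> y ys; apply: sK; rewrite inE ys orbT.
  exists (D `&` [set w | val w `&` lines_hitting (hball z (1 / 8)) !=set0]); split.
  - apply: mvoidI => //; exact: mvoid_hit (bounded_hitting _ _).
  - move=> w [/DE[rw sw] zw]; split=> // y; rewrite inE => /orP[/eqP -> //|].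
    exact: sw.
  - move=> w w' [Dw [L [wL zL]]] ww' h; split; first exact: mono Dw ww' h.
    by exists L; split=> //; exact: ww'.
  - apply: (@insert_line _ _ r) => //.
    by have := sK z (mem_head _ _); rewrite /hball/=; lra.
suff : p D <= p all_linked by lra.
apply: p_le => // w /DE[rw sw]; apply: (rooted_covered _ rw); first by rewrite /r; lra.
move=> x xr.
(* A point in the outer shell is first pulled back radially into the ball that carries the net. *)
have [y yr xy] : exists2 y, mdist o y <= r - 1 / 8 & mdist y x <= 1 / 8.
  have [xr'|xr'] := leP (mdist o x) (r - 1 / 8).
    by exists x; rewrite ?mdistxx//; lra.
  have [|y oy yx] := @point_at _ _ o x (r - 1 / 8); first by rewrite /r in xr' *; lra.
  by exists y; rewrite ?oy ?yx; lra.
have [z zs zy] := hs y yr; have [L [wL [_ Lz]]] := sw z zs.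
exists L => //; apply: hits_shift Lz.
by have := metric_triangle z y x; lra.
Qed.

(** Every ball is then almost surely hit by no line, so the configuration is almost surely empty and
    trivially linked. *)
Lemma null_measure_empty :
  (forall B, bounded_lines B -> mu B = 0%E) -> P.-negligible (~` all_linked).
Proof.
move=> mu0; apply: (@negligibleS _ _ _ P
    (\bigcup_n ~` avoid (lines_hitting (hball o n%:R)))).
  move=> w h; apply: contrapT => h'; apply: h => L L' wL _; exfalso; apply: h'.
  have hL := config_line wL; have [x Lx] := line_nonempty hL.
  exists (Num.truncn (mdist o x)).+1 => //; rewrite avoidC.
  exists L; split=> //; split=> //; exists x; split=> //.
  exact/ltW/truncnS_gt.
apply: negligible_bigcup => n; have hB := bounded_hitting o n%:R.
have mA := mvoid_avoid hB.
apply/negligibleP; first by apply: measurable_mvoid; exact: mvoidC.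
apply: (etrans (PE (mvoidC mA))); rewrite pC// avoid_probability// mu0//= mulr0 oppr0 expR0.
by rewrite subrr.
Qed.

Lemma infinite_components_ae : (u%:E < critical_intensity mu)%E ->
  {ae P, forall w, infinite_set (infinite_components (occupied w))}.
Proof.
move=> huc; have [q qP] := @hyp_separable R d.
have mE := mvoid_all_linked qP.
(* Otherwise [P] would witness that [u] belongs to the set whose infimum is the critical
   intensity. *)
have not_linked : ~ P.-negligible (~` all_linked).
  move=> h; move: huc; rewrite ltNge => /negP; apply.
  apply: ereal_inf_lbound; exists u => //; split=> //; exists P => //.
  apply: negligibleS h => w /= + lw; apply; exact: all_linked_connected.
have rho0 : 0 < 1 / 8 :> R by lra.
have mu0 : mu (lines_hitting (hball o (1 / 8))) <> 0%E.
  move=> h; apply: not_linked; apply: null_measure_empty.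
  exact: (null_ball_null hmu rho0 h).
have E0 : p all_linked = 0.
  have [|//|E1] := @zero_one all_linked mE.
    move=> x; apply: all_linked_move; first exact: reflectionK.
    exact: mdist_reflection.
  case: not_linked; apply/negligibleP.
    by apply: measurable_mvoid; exact: mvoidC.
  by apply: (etrans (PE (mvoidC mE))); rewrite pC// E1 subrr.
(* The exceptional event is covered by countably many rooted events, each of probability 0. *)
apply: (@negligibleS _ _ _ P (\bigcup_n rooted n%:R)).
  move=> w /= /contrapT fin; have [n hn] := finite_components_rooted fin.
  by exists n.
apply: negligible_bigcup => n; apply/negligibleP.
  exact: measurable_mvoid (mvoid_rooted qP _).
by apply: (etrans (PE (mvoid_rooted qP _))); rewrite rooted_null.
Qed.

End Poisson.

Theorem proposition1p3 (R : realType) (d : nat) (hd : (2 <= d)%N)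
    (mu : {measure set (line_space R d) -> \bar R})
    (hmu : invariant_line_measure mu)
    (u : R) (hu0 : 0 < u) (huc : (u%:E < critical_intensity mu)%E)
    (P : probability (config_space R d) R)
    (hP : poisson_process (fun B => (u%:E * mu B)%E) P) :
  {ae P, forall w, infinite_set (infinite_components (occupied w))}.
Proof. exact (@infinite_components_ae R d mu hd hmu u P hu0 hP huc). Qed.
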